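(* For every space $Y$ in $\mathcal{U}$ there is a KW-complex $X$ (which lies in $\mathcal{U}$) and a map $X\to Y$ that is a weak equivalence in the sense that $\underline{\mathcal{U}}(K,X)\to\underline{\mathcal{U}}(K,Y)$ is a weak homotopy equivalence for every compact Hausdorff space $K$.
   Context: $\mathcal{U}$ is the category of compactly generated weakly Hausdorff spaces, and $\underline{\mathcal{U}}(K,X)$ is the space of continuous maps with the compactly generated modification of the compact-open topology. A KW-complex is a topological space $X$ built as follows: $X^0$ is a disjoint union of compact Hausdorff spaces; for $n\ge1$, $X^n$ is the pushout in the category of all topological spaces of $X^{n-1}\leftarrow \partial\Delta_n\times Y_n\to\Delta_n\times Y_n$ for some continuous attaching map and some $Y_n$ that is a disjoint union of compact Hausdorff spaces (here $\Delta_n$ is the topological $n$-simplex and $\partial\Delta_n$ its boundary, the right map the inclusion); and $X=\operatorname{colim}_n X^n$ in topological spaces. *)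

(* Defs.v *)
From HB Require Import structures.
From mathcomp Require Import all_boot all_order all_algebra.
From Stdlib Require Rdefinitions.
From mathcomp Require Import all_classical all_reals topology.
From mathcomp Require Import Rstruct Rstruct_topology.
Set Implicit Arguments. Unset Strict Implicit. Unset Printing Implicit Defensive.
Import Order.TTheory GRing.Theory Num.Theory.
Local Open Scope classical_set_scope.
Local Open Scope ring_scope.

Notation RR := Rdefinitions.R.

Definition compact_hausdorff (K : topologicalType) : Prop :=
  compact [set: K] /\ hausdorff_space K.

Definition kopen (T : topologicalType) (A : set T) : Prop :=
  forall (K : topologicalType) (u : K -> T),
    compact_hausdorff K -> continuous u -> open (u @^-1` A).

Definition compactly_generated (T : topologicalType) : Prop :=
  forall A : set T, kopen A -> open A.

Definition weak_hausdorff (T : topologicalType) : Prop :=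
  forall (K : topologicalType) (u : K -> T),
    compact_hausdorff K -> continuous u -> closed (range u).

Definition in_U (T : topologicalType) : Prop :=
  compactly_generated T /\ weak_hausdorff T.

Definition kify (T : topologicalType) : Type := T.
HB.instance Definition _ (T : topologicalType) := Choice.on (kify T).

Section kify_topology.
Variable T : topologicalType.

Let kop : set_system (kify T) := fun A => @kopen T A.

Let kopT : kop setT.
Proof. by move=> K u _ _; rewrite preimage_setT; exact: openT. Qed.

Let kopI : setI_closed kop.
Proof. by move=> A B oA oB K u hK cu; rewrite preimage_setI; apply: openI; [exact: oA|exact: oB]. Qed.

Let kop_bigU (I : Type) (f : I -> set (kify T)) :
  (forall i, kop (f i)) -> kop (\bigcup_i f i).
Proof.
move=> oF K u hK cu; rewrite preimage_bigcup; apply: bigcup_open => i _.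
exact: oF.
Qed.

HB.instance Definition _ := isOpenTopological.Build (kify T) kopT kopI kop_bigU.
End kify_topology.

Definition cmaps (K X : topologicalType) : set {compact-open, K -> X} :=
  [set f | continuous (f : K -> X)].

Definition Map (K X : topologicalType) : topologicalType :=
  kify (set_type (@cmaps K X)).

Definition postcomp (K X Y : topologicalType) (f : X -> Y) (hf : continuous f)
  (g : Map K X) : Map K Y.
Proof.
refine (exist _ (f \o (sval (g : set_type (@cmaps K X)) : K -> X) : {compact-open, K -> Y}) _).
apply/mem_set => x; apply: continuous_comp; last exact: hf.
by case: g => g /= /set_mem; apply.
Defined.

Unset Implicit Arguments.

Definition Rn (n : nat) := {ptws 'I_n -> RR}.

Definition unit_interval : set RR := [set t | 0 <= t <= 1].

Definition cube (n : nat) : set (Rn n) := [set x | forall i, 0 <= x i <= 1].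
Definition cube_bdry (n : nat) : set (Rn n) :=
  [set x | cube n x /\ exists i, x i = 0 \/ x i = 1].
Definition cylinder (n : nat) : set (RR * Rn n)%type :=
  [set p | unit_interval p.1 /\ cube n p.2].

(** representatives of elements of pi_n(T, x0): maps (I^n, dI^n) -> (T, x0) *)
Definition sph_map {T : topologicalType} (n : nat) (x0 : T) (a : Rn n -> T) : Prop :=
  {within cube n, continuous a} /\ (forall y, cube_bdry n y -> a y = x0).

Definition homotopic_rel {T : topologicalType} (n : nat) (x0 : T)
    (a b : Rn n -> T) : Prop :=
  exists H : (RR * Rn n)%type -> T,
    [/\ {within cylinder n, continuous H},
        (forall y, cube n y -> H (0, y) = a y /\ H (1, y) = b y) &
        (forall t y, unit_interval t -> cube_bdry n y -> H (t, y) = x0)].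

Definition path_joined {T : topologicalType} (x y : T) : Prop :=
  exists p : RR -> T,
    [/\ {within unit_interval, continuous p}, p 0 = x & p 1 = y].

(** f is a weak homotopy equivalence: f is continuous, induces a bijection
    pi_0(A) -> pi_0(B), and a bijection pi_n(A, x0) -> pi_n(B, f x0) for every
    n >= 1 and every base point x0 (pi_n being the set of homotopy classes of
    maps (I^n, dI^n) -> (A, x0) rel dI^n). *)
Definition weak_homotopy_equivalence (A B : topologicalType) (f : A -> B) : Prop :=
  [/\ continuous f,
      (forall b : B, exists a : A, path_joined (f a) b),
      (forall a a' : A, path_joined (f a) (f a') -> path_joined a a'),
      (forall (n : nat) (x0 : A) (b : Rn n.+1 -> B), sph_map n.+1 (f x0) b ->
         exists2 a, sph_map n.+1 x0 a & homotopic_rel n.+1 (f x0) (f \o a) b) &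
      (forall (n : nat) (x0 : A) (a a' : Rn n.+1 -> A),
         sph_map n.+1 x0 a -> sph_map n.+1 x0 a' ->
         homotopic_rel n.+1 (f x0) (f \o a) (f \o a') ->
         homotopic_rel n.+1 x0 a a')].

Definition simplex (n : nat) : set (Rn n.+1) :=
  [set x | (forall i, 0 <= x i) /\ \sum_(i < n.+1) x i = 1].
Definition simplex_bdry (n : nat) : set (set_type (simplex n)) :=
  [set x | exists i, sval x i = 0].

Definition bdry_incl (n : nat) (Y : Type)
  (p : (set_type (simplex_bdry n) * Y)%type) : (set_type (simplex n) * Y)%type :=
  (sval p.1, p.2).

Definition is_pushout {A B C Q : topologicalType} (i : A -> B) (f : A -> C)
    (j : C -> Q) (g : B -> Q) : Prop :=
  [/\ continuous j, continuous g, j \o f = g \o i &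
      forall (Z : topologicalType) (h : C -> Z) (k : B -> Z),
        continuous h -> continuous k -> h \o f = k \o i ->
        exists! u : Q -> Z, [/\ continuous u, u \o j = h & u \o g = k]].

Definition is_seq_colimit {S : nat -> topologicalType}
    (s : forall n, S n -> S n.+1) {X : topologicalType}
    (c : forall n, S n -> X) : Prop :=
  [/\ forall n, continuous (c n),
      forall n, c n.+1 \o s n = c n &
      forall (Z : topologicalType) (h : forall n, S n -> Z),
        (forall n, continuous (h n)) -> (forall n, h n.+1 \o s n = h n) ->
        exists! u : X -> Z, continuous u /\ forall n, u \o c n = h n].

Definition homeomorphic (A B : topologicalType) : Prop :=
  exists (f : A -> B) (g : B -> A),
    [/\ continuous f, continuous g, cancel f g & cancel g f].

(** KW-structure on X.  kw_idx n / kw_cell n : the space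
    Y_n = coprod_(i : kw_idx n) kw_cell n i  (a disjoint union of compact
    Hausdorff spaces, with the sum topology).  kw_skel n = X^n. *)
Record KW_structure (X : topologicalType) := KWStructure {
  kw_skel : nat -> topologicalType;
  kw_idx : nat -> choiceType;
  kw_cell : forall n, kw_idx n -> topologicalType;
  kw_cell_compact_hausdorff : forall n i, compact_hausdorff (kw_cell n i);
  kw_skel0 : homeomorphic {i : kw_idx 0 & kw_cell 0 i} (kw_skel 0);
  kw_attach : forall n,
    (set_type (simplex_bdry n.+1) * {i : kw_idx n.+1 & kw_cell n.+1 i})%type ->
    kw_skel n;
  kw_attach_continuous : forall n, continuous (kw_attach n);
  kw_incl : forall n, kw_skel n -> kw_skel n.+1;
  kw_char : forall n,
    (set_type (simplex n.+1) * {i : kw_idx n.+1 & kw_cell n.+1 i})%type ->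
    kw_skel n.+1;
  kw_pushout : forall n,
    is_pushout (@bdry_incl n.+1 _) (kw_attach n) (kw_incl n) (kw_char n);
  kw_toX : forall n, kw_skel n -> X;
  kw_colimit : is_seq_colimit kw_incl kw_toX
}.

Definition is_KW_complex (X : topologicalType) : Prop :=
  inhabited (KW_structure X).

(* Main.v *)
Require Import Defs.
From HB Require Import structures.
From mathcomp Require Import all_boot all_order all_algebra.
From mathcomp Require Import all_classical all_reals topology.
From mathcomp Require Import normedtype Rstruct Rstruct_topology finmap lra.
Set Implicit Arguments. Unset Strict Implicit. Unset Printing Implicit Defensive.
Import Order.TTheory GRing.Theory Num.Theory numFieldNormedType.Exports.
Local Open Scope classical_set_scope.
Local Open Scope ring_scope.

(** The space X is the realisation of the nerve of the cover of Y by its closed compact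
    Hausdorff subspaces C_p: its points are pairs (x, t) with t a finitely supported
    system of barycentric coordinates on the indices p and x in C_p for all p in the
    support of t.  The n-cells are simplices times intersections of n + 1 members of the
    cover, so X is a KW-complex, and X -> Y is the projection (x, t) |-> x.

    The projection has a lifting property up to a collar.  Let K be compact Hausdorff,
    let b : D x K -> Y be a map on a disk D and let a be a lift of b to X over the
    boundary of D.  The image of b is compact Hausdorff because Y is weakly Hausdorff,
    hence it is some C_p.  On the collar push a(q, k) = (x, t) linearly to
    (x, the vertex p), and on the inner disk use (b, the vertex p).  Applying this to
    the interval, to cubes and to cylinders gives the statements on homotopy groups. *)

(** * Compact Hausdorff and weakly Hausdorff spaces *)

Section generic_topology.

(** A strict lift of [b] is out of reach: as long as the coordinate at an index [q] is positive, the
    point of Y must stay in [C q], so the Y-component is not free to move until all weight has gone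
    to [p]. Hence it is frozen on the collar, and what gets lifted is [b] precomposed with the map
    that stretches the inner half disk over the whole disk; that map is homotopic to the identity
    relative to the sphere. The push is legitimate because [a] covers [b]: its points already lie
    over [C p], so [p] may be added to their support. One index serves all of D x K, hence no
    subdivision of the disk occurs. The space K enters only through currying. The delicate point is
    topological. X carries the colimit topology of its cells, as the universal properties of a
    KW-complex require, so continuity of the push on X x [RR] rests on the local compactness of
    [RR]. Moreover Y is only weakly Hausdorff, so separation arguments go through closed images of
    compact Hausdorff spaces. *)

Definition subpt (T : Type) (A : set T) (x : T) (Ax : A x) : set_type A :=
  exist _ x (mem_set Ax).

Lemma continuous_into_subtype (Z T : topologicalType) (A : set T)
    (f : Z -> set_type A) :
  continuous (fun z => set_val (f z)) -> continuous f.
Proof. exact: continuous_comp_initial. Qed.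

Lemma continuous_set_val (T : topologicalType) (A : set T) :
  continuous (fun x : set_type A => set_val x).
Proof. exact: initial_continuous. Qed.

Lemma continuous_into_ptws (Z V : topologicalType) (I : Type)
    (f : Z -> {ptws I -> V}) :
  (forall i, continuous (fun z => f z i)) -> continuous f.
Proof.
move=> cf z; apply/cvg_sup => i.
have : continuous (f : Z -> initial_topology (fun g : I -> V => g i)).
  by apply: continuous_comp_initial; exact: cf.
by move=> /(_ z).
Qed.

Lemma continuous_ptws_eval (V : topologicalType) (I : eqType) (i : I) :
  continuous (fun f : {ptws I -> V} => f i).
Proof. exact: (@proj_continuous I (fun=> V) i). Qed.

Lemma continuous_pair (Z A B : topologicalType) (f : Z -> A) (g : Z -> B) :
  continuous f -> continuous g -> continuous (fun z => (f z, g z)).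
Proof. by move=> cf cg z; apply: cvg_pair; [exact: cf|exact: cg]. Qed.

Lemma continuous_fst (A B : topologicalType) : continuous (@fst A B).
Proof. by move=> z; exact: cvg_fst. Qed.

Lemma continuous_snd (A B : topologicalType) : continuous (@snd A B).
Proof. by move=> z; exact: cvg_snd. Qed.

Lemma continuous_o (A B C : topologicalType) (f : A -> B) (g : B -> C) :
  continuous f -> continuous g -> continuous (fun x => g (f x)).
Proof. by move=> cf cg x; apply: continuous_comp; [exact: cf|exact: cg]. Qed.

Lemma continuous_constant (A B : topologicalType) (b : B) :
  continuous (fun _ : A => b).
Proof. by move=> x; exact: cvg_cst. Qed.

Lemma closed_preimage (A B : topologicalType) (f : A -> B) (D : set B) :
  continuous f -> closed D -> closed (f @^-1` D).
Proof. by move=> /continuous_closedP; apply. Qed.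

Lemma hausdorff_inj (A B : topologicalType) (f : A -> B) :
  continuous f -> injective f -> hausdorff_space B -> hausdorff_space A.
Proof.
move=> cf fI hB x y cxy; apply: fI; apply: hB => U V /cf Ux /cf Vy.
by have [z [Uz Vz]] := cxy _ _ Ux Vy; exists (f z).
Qed.

Lemma hausdorff_prod (A B : topologicalType) :
  hausdorff_space A -> hausdorff_space B -> hausdorff_space (A * B)%type.
Proof.
move=> hA hB [a b] [a' b'] cl; congr pair.
  apply: hA => U V Ua Va; have [z [Uz Vz]] := cl (fst @^-1` U) (fst @^-1` V)
    (@continuous_fst _ _ (a, b) _ Ua) (@continuous_fst _ _ (a', b') _ Va).
  by exists z.1.
apply: hB => U V Ua Va; have [z [Uz Vz]] := cl (snd @^-1` U) (snd @^-1` V)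
  (@continuous_snd _ _ (a, b) _ Ua) (@continuous_snd _ _ (a', b') _ Va).
by exists z.2.
Qed.

Lemma compact_hausdorff_prod (A B : topologicalType) :
  compact_hausdorff A -> compact_hausdorff B -> compact_hausdorff (A * B)%type.
Proof.
move=> [cA hA] [cB hB]; split; last exact: hausdorff_prod.
by rewrite -setXTT; exact: compact_setX.
Qed.

Lemma compact_subtype (T : topologicalType) (A : set T) :
  compact A -> compact [set: set_type A].
Proof.
move=> cA F FF _.
have FA : (set_val @ F) A.
  by apply: (@filterS _ F _ setT); [move=> x _; exact: set_valP|exact: filterT].
have [p [Ap cl]] := cA (set_val @ F) _ FA.
exists (subpt Ap); split=> // U V FU.
move=> [W [[O oO <-] /= Op] OV].
have FU' : (set_val @ F) (set_val @` U).
  by apply: (@filterS _ F _ U) FU => x Ux /=; exists x.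
have [_ [[x Ux <-] Ox]] := cl _ _ FU' (open_nbhs_nbhs (conj oO Op)).
by exists x; split => //; exact: OV.
Qed.

Lemma compact_hausdorff_closed (K : topologicalType) (A : set K) :
  compact_hausdorff K -> closed A -> compact_hausdorff (set_type A).
Proof.
move=> [cK hK] cA; split.
  by apply: compact_subtype; exact: subclosed_compact cK _.
by apply: hausdorff_inj hK; [exact: continuous_set_val|exact: val_inj].
Qed.

Lemma compact_range (K T : topologicalType) (u : K -> T) :
  compact [set: K] -> continuous u -> compact (range u).
Proof. by move=> cK cu; apply: continuous_compact => //; exact: continuous_subspaceT. Qed.

Lemma closed_proj_compact (A K : topologicalType) (D : set (A * K)%type) :
  compact_hausdorff A -> compact_hausdorff K -> closed D ->
  closed [set a | exists k, D (a, k)].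
Proof.
move=> hA hK cD; have [cAK _] := compact_hausdorff_prod hA hK.
have -> : [set a | exists k, D (a, k)] = fst @` D.
  by rewrite eqEsubset; split=> [a [k]|_ [[a k] ? <-]]; [exists (a, k)|exists k].
apply: compact_closed; first exact: hA.2.
apply: continuous_compact; first by apply: continuous_subspaceT; exact: continuous_fst.
exact: subclosed_compact cAK _.
Qed.

Lemma closed_image_weak_hausdorff (K T : topologicalType) (u : K -> T) (A : set K) :
  weak_hausdorff T -> compact_hausdorff K -> continuous u -> closed A ->
  closed (u @` A).
Proof.
move=> wT hK cu cA.
have -> : u @` A = range (fun x : set_type A => u (set_val x)).
  rewrite eqEsubset; split=> [_ [x Ax <-]|_ [x _ <-]].
    by exists (subpt Ax).
  by exists (set_val x) => //; exact: set_valP.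
apply: wT; first exact: compact_hausdorff_closed.
by apply: continuous_o cu; exact: continuous_set_val.
Qed.

Lemma compact_hausdorff_regular (K : topologicalType) (k : K) (U : set K) :
  compact_hausdorff K -> nbhs k U -> exists2 V, nbhs k V & closed V /\ V `<=` U.
Proof.
move=> [cK hK] /(compact_regular hK cK filterT)[V Vk VU].
exists (closure V); first by apply: filterS Vk; exact: subset_closure.
by split => //; exact: closed_closure.
Qed.

Lemma weak_hausdorff_set1 (T : topologicalType) (y : T) :
  weak_hausdorff T -> closed [set y].
Proof.
move=> wT; have -> : [set y] = range (fun x : set_type [set y] => set_val x).
  rewrite eqEsubset; split=> [_ ->|_ [x _ <-]]; last exact: set_valP.
  by exists (exist _ y (mem_set (erefl y))).
apply: wT; last exact: continuous_set_val.
split; first by apply: compact_subtype; exact: compact_set1.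
by move=> a b _; apply: val_inj; rewrite (set_valP a) (set_valP b).
Qed.

(** Replaces closedness of the diagonal of T. If [u k] differs from [v l], regularity of K gives a
    closed neighbourhood V of k that misses the fibre over [v l]; its image is closed in T, so V
    times the set of points that [v] sends outside this image is a neighbourhood without
    coincidences. *)
Lemma closed_fiber_product (T K L : topologicalType) (u : K -> T) (v : L -> T) :
  weak_hausdorff T -> compact_hausdorff K -> continuous u -> continuous v ->
  closed [set p : (K * L)%type | u p.1 = v p.2].
Proof.
move=> wT hK cu cv; rewrite -openC openE => -[k l] /= neq.
have : nbhs k (~` (u @^-1` [set v l])).
  apply: open_nbhs_nbhs; split => //; apply: closed_openC.
  by apply: closed_preimage => //; exact: weak_hausdorff_set1.
move=> /(compact_hausdorff_regular hK)[V Vk [cV VU]].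
exists (V, v @^-1` (~` (u @` V))); last first.
  by move=> [k' l'] /= [Vk' nv] e; apply: nv; exists k'.
split => //=; apply: cv; apply: open_nbhs_nbhs; split.
  by apply: closed_openC; exact: closed_image_weak_hausdorff.
by move=> [k' Vk' e]; exact: (VU _ Vk').
Qed.

(** Distinct points have disjoint closed fibres in the normal space K. Separating the fibres there
    and taking complements of images of closed sets transports the separation to the image. *)
Lemma compact_hausdorff_image (T K : topologicalType) (u : K -> T) :
  weak_hausdorff T -> compact_hausdorff K -> continuous u ->
  compact_hausdorff (set_type (range u)).
Proof.
move=> wT hK cu; split.
  by apply: compact_subtype; apply: compact_range => //; exact: hK.1.
rewrite open_hausdorff => x y /eqP xy.
have nK : normal_space K by apply: compact_normal; [exact: hK.2|exact: hK.1].
have clp z : closed (u @^-1` [set z]).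
  by apply: closed_preimage => //; exact: weak_hausdorff_set1.
have [U Ux clUy] : exists2 U, set_nbhs (u @^-1` [set set_val x]) U &
    closure U `<=` ~` (u @^-1` [set set_val y]).
  have : set_nbhs (u @^-1` [set set_val x]) (~` (u @^-1` [set set_val y])).
    apply/set_nbhsP; exists (~` (u @^-1` [set set_val y])); split => //.
      exact: closed_openC.
    by move=> k /= -> e; apply: xy; apply: val_inj.
  by move=> /(nK _ (clp _))[U nU cU]; exists U.
have cl1 : closed (u @` closure U) by apply: closed_image_weak_hausdorff => //; exact: closed_closure.
have cl2 : closed (u @` (~` U°)).
  by apply: closed_image_weak_hausdorff => //; apply: open_closedC; exact: open_interior.
(* The fibre of x lies in the interior of U, and the fibre of y outside the closure of U. Every k
   lies in [closure U] or in the complement of the interior, so no point of the image avoids both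
   closed sets. *)
exists (set_val @^-1` (~` (u @` (~` U°))), set_val @^-1` (~` (u @` closure U))).
  by split; apply/mem_set => -[k nk e]; [apply: nk; exact: Ux|exact: clUy nk e].
split => /=.
- by apply: open_comp => [? _|]; [exact: continuous_set_val|exact: closed_openC].
- by apply: open_comp => [? _|]; [exact: continuous_set_val|exact: closed_openC].
- apply/eqP; rewrite -subset0 => z [/= n1 n2]; have [k _ e] := set_valP z.
  have [Uk|nUk] := pselect (U° k).
    by apply: n2; exists k => //; apply: subset_closure; exact: interior_subset.
  by apply: n1; exists k.
Qed.

End generic_topology.

(** * The nerve of a cover *)

Section real_valued.
Variable Z : topologicalType.
Implicit Types f g : Z -> RR.

Lemma continuous_add f g :
  continuous f -> continuous g -> continuous (fun z => f z + g z).
Proof. by move=> cf cg z; exact: (@cvgD RR RR^o Z _ _ f g _ _ (cf z) (cg z)). Qed.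

Lemma continuous_sub f g :
  continuous f -> continuous g -> continuous (fun z => f z - g z).
Proof. by move=> cf cg z; exact: (@cvgB RR RR^o Z _ _ f g _ _ (cf z) (cg z)). Qed.

Lemma continuous_mul f g :
  continuous f -> continuous g -> continuous (fun z => f z * g z).
Proof. by move=> cf cg z; exact: (@cvgM RR Z _ _ f g _ _ (cf z) (cg z)). Qed.

Lemma continuous_maxr f g :
  continuous f -> continuous g -> continuous (fun z => Num.max (f z) (g z)).
Proof. by move=> cf cg z; exact: (@continuous_max RR Z f g z (cf z) (cg z)). Qed.

Lemma continuous_minr f g :
  continuous f -> continuous g -> continuous (fun z => Num.min (f z) (g z)).
Proof. by move=> cf cg z; exact: (@continuous_min RR Z f g z (cf z) (cg z)). Qed.

Lemma continuous_sumr (I : Type) (s : seq I) (f : I -> Z -> RR) :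
  (forall i, continuous (f i)) -> continuous (fun z => \sum_(i <- s) f i z).
Proof.
move=> cf; elim: s => [|i s IH].
  rewrite (_ : (fun _ => _) = fun=> 0); first exact: continuous_constant.
  by apply/funext => z; rewrite big_nil.
rewrite (_ : (fun _ => _) = fun z => f i z + \sum_(i <- s) f i z).
  exact: continuous_add.
by apply/funext => z; rewrite big_cons.
Qed.

Lemma closed_eq_fun f g :
  continuous f -> continuous g -> closed [set z | f z = g z].
Proof.
move=> cf cg; have -> : [set z | f z = g z] = (fun z => f z - g z) @^-1` [set 0].
  rewrite eqEsubset; split=> z /=; first by move=> ->; rewrite subrr.
  by move=> /eqP; rewrite subr_eq0 => /eqP.
by apply: closed_preimage; [exact: continuous_sub|exact: closed_eq].
Qed.

Lemma closed_le_fun f g :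
  continuous f -> continuous g -> closed [set z | f z <= g z].
Proof.
move=> cf cg; have -> : [set z | f z <= g z] = (fun z => g z - f z) @^-1` [set x | 0 <= x].
  by rewrite eqEsubset; split=> z /=; rewrite subr_ge0.
by apply: closed_preimage; [exact: continuous_sub|exact: closed_ge].
Qed.

End real_valued.

(** * The nerve of a closed cover, topologised as the colimit of its closed cells *)

Section cech_complex.
Variables (Y : topologicalType) (P : choiceType) (C : P -> set Y).

Local Notation B := (Y * {ptws P -> RR})%type.

(** The closed simplex on F times the intersection of the [C p]. Coordinates may vanish on part of
    F, so smaller faces are included, but the point of Y must lie in [C p] for every p in F. The sum
    condition makes the cell of the empty F empty. *)
Definition in_cell (F : {fset P}) : set B :=
  [set z | [/\ forall p, p \in F -> C p z.1, forall p, 0 <= z.2 p,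
               forall p, p \notin F -> z.2 p = 0 &
               \sum_(p <- F) z.2 p = 1]].

(** The predicate [d] on the number of vertices treats all skeleta and the full nerve ([xpredT]) by
    one construction. *)
Definition cech_points (d : pred nat) : set B :=
  [set z | exists2 F : {fset P}, d #|` F| & in_cell F z].

Definition cech (d : pred nat) : Type := set_type (cech_points d).
HB.instance Definition _ d := Choice.on (cech d).

Definition cech_val d (x : cech d) : B := set_val (x : set_type (cech_points d)).

Lemma cech_val_inj d : injective (@cech_val d).
Proof. exact: val_inj. Qed.

Definition cech_mk d (z : B) (zd : cech_points d z) : cech d :=
  exist _ z (mem_set zd).

Definition cell_map (d : pred nat) (F : {fset P}) (dF : d #|` F|) (z : set_type (in_cell F)) :
  cech d :=
  cech_mk (ex_intro2 _ _ F dF (set_valP z)).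

Section cech_topology.
Variable d : pred nat.

(** The final topology for the cell maps; it refines the topology induced from the ambient product,
    which need not have the universal property of the colimit. *)
Let op : set_system (cech d) :=
  fun A => forall (F : {fset P}) (dF : d #|` F|), open (cell_map dF @^-1` A).

Let opT : op setT.
Proof. by move=> F dF; rewrite preimage_setT; exact: openT. Qed.

Let opI : setI_closed op.
Proof. by move=> U V oU oV F dF; rewrite preimage_setI; apply: openI; [exact: oU|exact: oV]. Qed.

Let op_bigU (I : Type) (f : I -> set (cech d)) :
  (forall i, op (f i)) -> op (\bigcup_i f i).
Proof.
by move=> oF F dF; rewrite preimage_bigcup; apply: bigcup_open => i _; exact: oF.
Qed.

HB.instance Definition _ := isOpenTopological.Build (cech d) opT opI op_bigU.

Lemma cech_openP (A : set (cech d)) :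
  open A <-> forall (F : {fset P}) (dF : d #|` F|), open (cell_map dF @^-1` A).
Proof. by []. Qed.

Lemma cech_closedP (A : set (cech d)) :
  closed A <-> forall (F : {fset P}) (dF : d #|` F|), closed (cell_map dF @^-1` A).
Proof.
rewrite -openC cech_openP; split=> h F dF; first by rewrite -openC preimage_setC.
by rewrite -preimage_setC openC; exact: h.
Qed.

Lemma continuous_cell_map (F : {fset P}) (dF : d #|` F|) : continuous (cell_map dF).
Proof. by apply/continuousP => A /cech_openP; apply. Qed.

Lemma continuous_from_cech (Z : topologicalType) (u : cech d -> Z) :
  (forall (F : {fset P}) (dF : d #|` F|), continuous (fun z => u (cell_map dF z))) ->
  continuous u.
Proof.
move=> cu; apply/continuousP => A oA; apply/cech_openP => F dF.
by move/continuousP : (cu F dF); exact.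
Qed.

Lemma continuous_cech_val : continuous (@cech_val d).
Proof. by apply: continuous_from_cech => F dF; exact: continuous_set_val. Qed.

Lemma cech_cellP (x : cech d) : exists (F : {fset P}) (dF : d #|` F|) z,
  x = cell_map dF z.
Proof.
have [F dF Fx] := set_valP (x : set_type (cech_points d)).
by exists F, dF, (subpt Fx); apply: val_inj.
Qed.

End cech_topology.

Lemma continuous_bary (p : P) : continuous (fun z : B => z.2 p).
Proof. by apply: continuous_o (@continuous_ptws_eval _ _ p); exact: continuous_snd. Qed.

Hypothesis C_closed : forall p, closed (C p).

Lemma closed_in_cell F : closed (in_cell F).
Proof.
have -> : in_cell F =
    (\bigcap_(p in [set p | p \in F]) (fst @^-1` C p)) `&`
    (\bigcap_p [set z : B | 0 <= z.2 p]) `&`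
    (\bigcap_(p in [set p | p \notin F]) [set z : B | z.2 p = 0]) `&`
    [set z : B | \sum_(p <- F) z.2 p = 1].
  rewrite eqEsubset; split=> z /=.
    move=> [h1 h2 h3 h4]; split; last exact: h4.
    split; last by move=> p; exact: h3.
    by split=> p; [exact: h1|move=> _; exact: h2].
  by move=> [[[h1 h2] h3] h4]; split => // p; exact: h2.
repeat apply: closedI.
- apply: closed_bigI => p _; apply: closed_preimage => //; exact: continuous_fst.
- apply: closed_bigI => p _; apply: closed_le_fun; last exact: continuous_bary.
  exact: continuous_constant.
- apply: closed_bigI => p _; apply: closed_eq_fun; first exact: continuous_bary.
  exact: continuous_constant.
- apply: closed_eq_fun; last exact: continuous_constant.
  by apply: continuous_sumr => p; exact: continuous_bary.
Qed.

(* On a finite union of closed cells the colimit topology is the subspace topology. *)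
Lemma continuous_into_cech d (Z : topologicalType) (phi : Z -> cech d)
    (Fs : seq {fset P}) :
  continuous (fun z => cech_val (phi z)) ->
  (forall z, exists2 F, F \in Fs & d #|` F| /\ in_cell F (cech_val (phi z))) ->
  continuous phi.
Proof.
move=> cphi cov; apply/continuous_closedP => A /cech_closedP cA.
have -> : phi @^-1` A = \bigcup_(F in [set F | F \in Fs /\ d #|` F|])
    ((fun z => cech_val (phi z)) @^-1`
      (in_cell F `&` [set w | exists2 x : cech d, A x & cech_val x = w])).
  rewrite eqEsubset; split=> z /= => [Az|[F _ [_ [x Ax /cech_val_inj <-]]]//].
  by have [F FFs [dF Fz]] := cov z; exists F => //; split => //; exists (phi z).
apply: closed_bigcup.
  apply: (@sub_finite_set _ _ [set` Fs]); last exact: finite_seq.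
  by move=> F [].
move=> F [_ dF]; apply: closed_preimage => //.
(* Cells carry the subspace topology and [cell_map] does not change values, so the part of A in the
   cell F is cut out by a set O closed in the ambient product. *)
have [O cO OA] : exists2 O : set B, closed O & set_val @^-1` O = cell_map dF @^-1` A.
  have := cA F dF; rewrite -openC => -[O oO OA]; exists (~` O); first exact: open_closedC.
  by rewrite -preimage_setC OA setCK.
have -> : in_cell F `&` [set w | exists2 x : cech d, A x & cech_val x = w] =
    in_cell F `&` O.
  rewrite eqEsubset; split=> w [Fw].
    move=> [x Ax xw]; split => //.
    have : (cell_map dF @^-1` A) (subpt Fw).
      by rewrite /preimage /=; congr A : Ax; apply: cech_val_inj; rewrite xw.
    by rewrite -OA.
  move=> Ow; split => //; exists (cell_map dF (subpt Fw)) => //.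
  have : (set_val @^-1` O) (subpt Fw) by [].
  by rewrite OA.
by apply: closedI => //; exact: closed_in_cell.
Qed.

Hypothesis C_cpt : forall p, compact_hausdorff (set_type (C p)).

Lemma compact_C p : compact (C p).
Proof.
have -> : C p = range (fun x : set_type (C p) => set_val x).
  rewrite eqEsubset; split=> [y Cy|_ [x _ <-]]; last exact: set_valP.
  by exists (subpt Cy).
by apply: compact_range; [exact: (C_cpt p).1|exact: continuous_set_val].
Qed.

Lemma in_cell_neq0 F z : in_cell F z -> exists p, p \in F.
Proof.
case=> _ _ _; have [->|/fset0Pn//] := eqVneq F fset0.
by rewrite big_seq_fset0 => /eqP; rewrite eq_sym oner_eq0.
Qed.

Lemma in_cell_le1 F z p : in_cell F z -> z.2 p <= 1.
Proof.
move=> [_ z0 zF <-]; have [pF|pF] := boolP (p \in F); last first.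
  by rewrite zF //; exact: sumr_ge0.
by rewrite (big_fsetD1 p) //= lerDl; exact: sumr_ge0.
Qed.

(** For any vertex [p0] of F the cell is closed in [C p0] times the cube of all coordinate systems
    with values in [0, 1], which is compact by Tychonoff. *)
Lemma compact_in_cell F : compact (in_cell F).
Proof.
have [->|/set0P[z0 /in_cell_neq0[p0 p0F]]] := eqVneq (in_cell F) set0; first exact: compact0.
pose A : set B := C p0 `*` [set t : {ptws P -> RR} | forall p, [set x | 0 <= x <= 1] (t p)].
have cA : compact A.
  apply: compact_setX; first exact: compact_C.
  apply: (@tychonoff P (fun=> RR) (fun=> [set x | 0 <= x <= 1])) => p.
  have -> : [set x : RR | 0 <= x <= 1] = `[0, 1]%classic.
    by rewrite eqEsubset; split => x; rewrite /= in_itv.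
  exact: segment_compact.
apply: subclosed_compact cA _; first exact: closed_in_cell.
move=> z Fz; split; first by case: Fz => h _ _ _; exact: h.
move=> p /=; rewrite (in_cell_le1 p Fz) andbT.
by case: Fz.
Qed.

(** The ambient product need not be Hausdorff, so the cell is injected into [C p] times the
    coordinate space for a vertex p of F. *)
Lemma compact_hausdorff_cell F : compact_hausdorff (set_type (in_cell F)).
Proof.
split; first by apply: compact_subtype; exact: compact_in_cell.
have [[p pF]|nF] := pselect (exists p, p \in F); last first.
  by move=> x; have /in_cell_neq0 := set_valP x.
pose g (x : set_type (in_cell F)) : set_type (C p) :=
  exist _ (set_val x).1 (mem_set (let: And4 h _ _ _ := set_valP x in h p pF)).
apply: (@hausdorff_inj _ (set_type (C p) * {ptws P -> RR})%type
  (fun x => (g x, (set_val x).2))).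
- apply: continuous_pair.
    apply: continuous_into_subtype; apply: continuous_o (@continuous_fst _ _).
    exact: continuous_set_val.
  by apply: continuous_o (@continuous_snd _ _); exact: continuous_set_val.
- by move=> x y [] e1 e2; apply: val_inj; apply: injective_projections.
- apply: hausdorff_prod; first exact: (C_cpt p).2.
  by apply: (@hausdorff_product P (fun=> RR)) => _; exact: Rhausdorff.
Qed.

Definition cech_proj d (x : cech d) : Y := (cech_val x).1.

Lemma continuous_cech_proj d : continuous (@cech_proj d).
Proof. by apply: continuous_o (@continuous_fst _ _); exact: continuous_cech_val. Qed.

Lemma compactly_generated_cech d : compactly_generated (cech d).
Proof.
move=> A kA; apply/cech_openP => F dF.
by apply: kA; [exact: compact_hausdorff_cell|exact: continuous_cell_map].
Qed.

Lemma weak_hausdorff_cech d : weak_hausdorff Y -> weak_hausdorff (cech d).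
Proof.
move=> wY K u hK cu; apply/cech_closedP => F dF.
have cuv : continuous (fun k => cech_val (u k)).
  by apply: continuous_o cu _; exact: continuous_cech_val.
(* The preimage of the range is the projection of a coincidence set along the compact K. The
   equation in Y is closed by [closed_fiber_product], each equation between coordinates because [RR]
   is Hausdorff. *)
have -> : cell_map dF @^-1` range u = [set z | exists k,
    ([set q : set_type (in_cell F) * K | (set_val q.1).1 = (cech_val (u q.2)).1] `&`
     \bigcap_p [set q : set_type (in_cell F) * K |
       (set_val q.1).2 p = (cech_val (u q.2)).2 p]) (z, k)].
  rewrite eqEsubset; split=> z /=.
    by move=> [k _ e]; exists k; split=> [|p _]; rewrite /= e.
  move=> [k [e1 e2]]; exists k => //; apply: cech_val_inj.
  apply: injective_projections; first exact/esym.
  by apply/funext => p; apply/esym; exact: (e2 p I).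
apply: closed_proj_compact => //; first exact: compact_hausdorff_cell.
apply: closedI.
  apply: (closed_fiber_product (u := fun z : set_type (in_cell F) => (set_val z).1)
    (v := fun k => (cech_val (u k)).1)) => //; first exact: compact_hausdorff_cell.
    by apply: continuous_o (@continuous_fst _ _); exact: continuous_set_val.
  by apply: continuous_o (@continuous_fst _ _).
apply: closed_bigI => p _; apply: closed_eq_fun.
  apply: continuous_o (@continuous_bary p).
  by apply: continuous_o (@continuous_set_val _ _); exact: continuous_fst.
apply: continuous_o (@continuous_bary p).
by apply: continuous_o cuv; exact: continuous_snd.
Qed.

End cech_complex.

(** * The KW-structure *)

(** Products distribute over disjoint unions for an arbitrary factor A, since neighbourhoods in a
    summand remain neighbourhoods in the sum. *)
Lemma continuous_prod_sigT (A Z : topologicalType) (I : choiceType)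
    (X : I -> topologicalType) (g : A * {i : I & X i} -> Z) :
  (forall i, continuous (fun q : A * X i => g (q.1, existT X i q.2))) ->
  continuous g.
Proof.
move=> cg [a [i x]] U /(cg i (a, x))[[V W] /= [Va Wx] VWU].
exists (V, existT X i @` W); first by split => //=; exact: existT_nbhs.
by move=> [b _] /= [Vb [w Ww <-]]; exact: (VWU (b, w)).
Qed.

Section cech_KW.
Variables (Y : topologicalType) (P : choiceType) (C : P -> set Y).
Hypothesis C_closed : forall p, closed (C p).
Hypothesis C_cpt : forall p, compact_hausdorff (set_type (C p)).

Local Notation B := (Y * {ptws P -> RR})%type.
Local Notation cech := (@cech Y P C).
Local Notation in_cell := (@in_cell Y P C).

Definition face_idx (n : nat) : choiceType := {F : {fset P} | #|` F| == n.+1}.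

Definition face_cap (F : {fset P}) : set Y := [set y | forall p, p \in F -> C p y].

Definition face_space n (i : face_idx n) : topologicalType :=
  set_type (face_cap (val i)).

Local Notation faces n := {i : face_idx n & face_space i}.

(** An arbitrary enumeration of the vertices. Enumerations of different faces need not be
    compatible, because points of the nerve record coordinates by elements of P and not by
    position. *)
Definition face_tuple n (i : face_idx n) : n.+1.-tuple P :=
  @Tuple n.+1 P (enum_fset (val i)) (valP i).

Definition vertex n (i : face_idx n) (j : 'I_n.+1) : P := tnth (face_tuple i) j.

(** On F the index is below n + 1, so the default value of [inord] never occurs. *)
Definition bary n (i : face_idx n) (t : Rn n.+1) : {ptws P -> RR} :=
  fun p => if p \in val i then t (inord (index p (face_tuple i))) else 0.

Lemma mem_vertex n (i : face_idx n) j : vertex i j \in val i.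
Proof. exact: (mem_tnth j (face_tuple i)). Qed.

Lemma uniq_face_tuple n (i : face_idx n) : uniq (face_tuple i).
Proof. exact: fset_uniq. Qed.

Lemma bary_vertex n (i : face_idx n) t j : bary i t (vertex i j) = t j.
Proof.
rewrite /bary mem_vertex; congr t; apply: val_inj => /=.
rewrite /vertex (tnth_nth (vertex i j)) index_uniq ?uniq_face_tuple ?size_tuple //.
by rewrite inordK.
Qed.

Lemma vertexP n (i : face_idx n) p : p \in val i -> exists j, p = vertex i j.
Proof. by move=> /(tnthP (face_tuple i))[j ->]; exists j. Qed.

Lemma sum_face n (i : face_idx n) (t : {ptws P -> RR}) :
  \sum_(p <- val i) t p = \sum_(j < n.+1) t (vertex i j).
Proof. by rewrite -(big_tuple _ _ (face_tuple i) xpredT). Qed.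

Lemma compact_hausdorff_face n (i : face_idx n) : compact_hausdorff (face_space i).
Proof.
have p0F := mem_vertex i ord0; set p0 := vertex i ord0 in p0F.
have cl : closed (face_cap (val i)).
  have -> : face_cap (val i) = \bigcap_(p in [set p | p \in val i]) C p by [].
  by apply: closed_bigI => p _.
split.
  have sub : face_cap (val i) `<=` C p0 by move=> y; exact.
  by apply: compact_subtype; apply: subclosed_compact sub => //; exact: compact_C.
pose g (y : face_space i) : set_type (C p0) :=
  exist _ (set_val y) (mem_set (set_valP y p0 p0F)).
apply: (@hausdorff_inj _ _ g); last exact: (C_cpt p0).2.
  by apply: continuous_into_subtype; exact: continuous_set_val.
by move=> x y [e]; exact: val_inj.
Qed.

Definition char_val n (c : set_type (simplex n) * faces n) : B :=
  (set_val (projT2 c.2), bary (projT1 c.2) (set_val c.1)).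

Lemma char_val_in_cell n (c : set_type (simplex n) * faces n) :
  in_cell (val (projT1 c.2)) (char_val c).
Proof.
case: c => t [i x] /=; have [t0 t1] := set_valP t; split => /=.
- exact: (set_valP x).
- by move=> p; rewrite /bary; case: ifP => // _; exact: t0.
- by move=> p /negbTE pF; rewrite /bary pF.
- by rewrite sum_face -t1; apply: eq_bigr => j _; exact: bary_vertex.
Qed.

(** An interior point of a simplex has its whole face as support, and the support is contained in
    every F whose cell contains the point. Hence the face can be read off from the value, which
    makes characteristic maps injective on open cells. *)
Lemma char_val_supp n (c : set_type (simplex n) * faces n) (F : {fset P}) :
  (forall j, set_val c.1 j != 0) -> in_cell F (char_val c) ->
  (val (projT1 c.2) `<=` F)%fset.
Proof.
case: c => t [i x] /= t0 [_ _ FN _]; apply/fsubsetP => _ /vertexP[j ->].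
by apply: contraT => /FN /=; rewrite bary_vertex => /eqP; rewrite (negbTE (t0 j)).
Qed.

Lemma char_val_inj n (c c' : set_type (simplex n) * faces n) :
  (forall j, set_val c.1 j != 0) -> (forall j, set_val c'.1 j != 0) ->
  char_val c = char_val c' -> c = c'.
Proof.
move=> c0 c'0 e.
have : val (projT1 c.2) = val (projT1 c'.2).
  apply/eqP; rewrite eqEfsubset; apply/andP; split.
    by apply: char_val_supp => //; rewrite e; exact: char_val_in_cell.
  by apply: char_val_supp => //; rewrite -e; exact: char_val_in_cell.
case: c c' e {c0 c'0} => t [i x] [t' [i' x']] /= [e1 e2] /val_inj ii'.
subst i'; congr (_, existT _ i _); last exact: val_inj.
apply: val_inj; apply/funext => j /=.
transitivity (bary i (set_val t) (vertex i j)); first exact/esym/bary_vertex.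
by rewrite e2; exact: bary_vertex.
Qed.

Lemma char_cech_points n (d : pred nat) (c : set_type (simplex n) * faces n) :
  d n.+1 -> cech_points C d (char_val c).
Proof.
move=> dn; exists (val (projT1 c.2)); last exact: char_val_in_cell.
by rewrite (eqP (valP (projT1 c.2))).
Qed.

Definition char_map n (d : pred nat) (dn : d n.+1)
  (c : set_type (simplex n) * faces n) : cech d := cech_mk (char_cech_points c dn).

Lemma continuous_char_val n (i : face_idx n) :
  continuous (fun q : set_type (simplex n) * face_space i =>
    char_val (q.1, existT _ i q.2)).
Proof.
apply: (@continuous_pair _ _ _
  (fun q : set_type (simplex n) * face_space i => set_val q.2)).
  by apply: continuous_o (@continuous_set_val _ _); exact: continuous_snd.
apply: continuous_into_ptws => p /=; rewrite /bary.
case: (p \in val i); last exact: continuous_constant.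
exact: (continuous_o (continuous_o (@continuous_fst _ _) (@continuous_set_val _ _))
  (@continuous_ptws_eval RR _ (inord (index p (face_tuple i))))).
Qed.

Lemma continuous_char_map n (d : pred nat) (dn : d n.+1) : continuous (@char_map n d dn).
Proof.
apply: continuous_prod_sigT => i.
apply: (continuous_into_cech C_closed (Fs := [:: val i])).
  exact: continuous_char_val.
move=> [t x]; exists (val i); first by rewrite inE.
split; first by rewrite (eqP (valP i)).
exact: (char_val_in_cell (t, existT _ i x)).
Qed.

Lemma lift_simplex n (i : face_idx n) (z : B) : in_cell (val i) z ->
  simplex n (fun j => z.2 (vertex i j)).
Proof. by case=> _ z0 _ z1; split => //; rewrite -sum_face. Qed.

Lemma lift_face n (i : face_idx n) (z : B) : in_cell (val i) z -> face_cap (val i) z.1.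
Proof. by case. Qed.

(** A continuous inverse of the characteristic map over a closed cell. Through it, maps defined on
    simplices times faces become maps on cells, where continuity out of the nerve is tested. *)
Definition cell_lift n (i : face_idx n) (z : set_type (in_cell (val i))) :
    set_type (simplex n) * faces n :=
  (subpt (lift_simplex (set_valP z)),
   existT (@face_space n) i (subpt (lift_face (set_valP z)))).

Lemma char_val_lift n (i : face_idx n) (z : set_type (in_cell (val i))) :
  char_val (cell_lift z) = set_val z.
Proof.
have [_ _ zN _] := set_valP z.
apply: injective_projections => //=; apply/funext => p; rewrite /bary.
have [pF|pF] := boolP (p \in val i); last by rewrite zN.
have [j ->] := vertexP pF; have := bary_vertex i (fun j => (set_val z).2 (vertex i j)) j.
by rewrite /bary mem_vertex.
Qed.

Lemma continuous_cell_lift n (i : face_idx n) : continuous (@cell_lift n i).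
Proof.
apply: continuous_pair.
  apply: continuous_into_subtype; apply: continuous_into_ptws => j.
  apply: continuous_o (@continuous_bary _ _ (vertex i j)).
  exact: continuous_set_val.
apply: continuous_o (@existT_continuous _ _ i).
apply: continuous_into_subtype; apply: continuous_o (@continuous_fst _ _).
exact: continuous_set_val.
Qed.

(** An n-simplex has n + 1 vertices, hence the shift. *)
Definition skel n : topologicalType := cech (fun m => m <= n.+1)%N.

Lemma cech_incl_points (d d' : pred nat) (dd' : forall m, d m -> d' m) (x : cech d) :
  cech_points C d' (cech_val x).
Proof. by have [F dF Fx] := set_valP (x : set_type _); exists F => //; exact: dd'. Qed.

Definition cech_incl (d d' : pred nat) (dd' : forall m, d m -> d' m) (x : cech d) :
  cech d' := cech_mk (cech_incl_points dd' x).

Lemma continuous_cech_incl (d d' : pred nat) (dd' : forall m, d m -> d' m) :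
  continuous (cech_incl dd').
Proof.
apply: continuous_from_cech => F dF; have := @continuous_cell_map _ _ C d' F (dd' _ dF).
rewrite (_ : (fun z => _) = cell_map (dd' _ dF)) //.
by apply/funext => z; exact: cech_val_inj.
Qed.

Definition skel_incl n : skel n -> skel n.+1 := cech_incl (fun m => @leqW m n.+1).

Definition skel_toX n : skel n -> cech xpredT := cech_incl (fun m _ => isT).

Definition skel_char n : set_type (simplex n) * faces n -> skel n :=
  @char_map n (fun m => m <= n.+1)%N (leqnn n.+1).

Lemma in_cell_face n (i : face_idx n.+1) (z : B) (j : 'I_n.+2) :
  in_cell (val i) z -> z.2 (vertex i j) = 0 -> in_cell (val i `\ vertex i j)%fset z.
Proof.
move=> [h1 h2 h3 h4] zj; split => //.
- by move=> p; rewrite inE => /andP[_]; exact: h1.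
- by move=> p; rewrite !inE negb_and negbK => /orP[/eqP->//|]; exact: h3.
- by rewrite -h4 [RHS](big_fsetD1 (vertex i j)) ?mem_vertex //= zj add0r.
Qed.

Lemma card_face n (i : face_idx n.+1) (j : 'I_n.+2) :
  (#|` (val i `\ vertex i j)%fset| <= n.+1)%N.
Proof.
by have := eqP (valP i); rewrite (cardfsD1 (vertex i j)) mem_vertex add1n => /succn_inj ->.
Qed.

Local Notation bdry n := (set_type (simplex_bdry n.+1) * faces n.+1)%type.

Lemma attach_cell n (c : bdry n) : exists j : 'I_n.+2,
  in_cell (val (projT1 c.2) `\ vertex (projT1 c.2) j)%fset (char_val (bdry_incl n.+1 _ c)).
Proof.
case: c => t [i x] /=; have [j tj] := set_valP t; exists j; apply: in_cell_face.
  exact: (char_val_in_cell (bdry_incl n.+1 _ (t, existT _ i x))).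
by rewrite /= bary_vertex.
Qed.

Lemma attach_points n (c : bdry n) :
  cech_points C (fun m => m <= n.+1)%N (char_val (bdry_incl n.+1 _ c)).
Proof.
have [j cj] := attach_cell c.
by exists (val (projT1 c.2) `\ vertex (projT1 c.2) j)%fset => //; exact: card_face.
Qed.

Definition attach n (c : bdry n) : skel n := cech_mk (attach_points c).

(** The boundary of one simplex is covered by its n + 2 opposite facets, a finite family of cells,
    so the colimit topology causes no trouble. *)
Lemma continuous_attach n : continuous (@attach n).
Proof.
apply: continuous_prod_sigT => i.
have c1 : continuous (fun q : set_type (simplex_bdry n.+1) * face_space i =>
    (set_val q.1, q.2)).
  apply: continuous_pair; last exact: continuous_snd.
  exact: (continuous_o (@continuous_fst _ _) (@continuous_set_val _ _)).
apply: (continuous_into_cech C_closed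
  (Fs := [seq (val i `\ vertex i j)%fset | j <- enum 'I_n.+2])).
  exact: (continuous_o c1 (@continuous_char_val _ i)).
move=> [t x]; have [j cj] := attach_cell (t, existT _ i x).
exists (val i `\ vertex i j)%fset; first by apply/mapP; exists j; rewrite ?mem_enum.
by split => //; exact: card_face.
Qed.

Lemma skel_cases n (z : skel n.+1) :
  (exists y, skel_incl y = z) \/ (exists c, skel_char c = z).
Proof.
have [F [dF [w ->]]] := cech_cellP z.
have [dF'|dF'] := leqP #|` F| n.+1.
  by left; exists (@cell_map _ _ _ (fun m => m <= n.+1)%N F dF' w); exact: cech_val_inj.
have eF : #|` F| == n.+2 by rewrite eqn_leq dF dF'.
right; exists (@cell_lift n.+1 (exist _ F eF) w); apply: cech_val_inj.
exact: char_val_lift.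
Qed.

(** An interior point has n + 2 vertices in its support, more than any cell of [skel n] offers; so
    the point has a vanishing coordinate. *)
Lemma skel_char_bdry n (y : skel n) (c : set_type (simplex n.+1) * faces n.+1) :
  skel_incl y = skel_char c -> exists2 b, attach b = y & bdry_incl n.+1 _ b = c.
Proof.
move=> e; have eV : cech_val y = char_val c by exact: (congr1 (@cech_val _ _ _ _) e).
have [[j cj]|nc] := pselect (exists j, set_val c.1 j = 0).
  have cb : simplex_bdry n.+1 c.1 by exists j.
  exists (subpt cb, c.2); last by rewrite [RHS]surjective_pairing.
  by apply: cech_val_inj; rewrite eV.
have [F [dF [w wE]]] := cech_cellP y.
suff /fsubset_leq_card : (val (projT1 c.2) `<=` F)%fset.
  by rewrite (eqP (valP (projT1 c.2))) leqNgt ltnS dF.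
apply: char_val_supp.
  by move=> j; apply/eqP => cj; apply: nc; exists j.
by rewrite -eV wE; exact: (set_valP w).
Qed.

Lemma skel_pushout n :
  is_pushout (@bdry_incl n.+1 _) (@attach n) (@skel_incl n) (@skel_char n.+1).
Proof.
split.
- exact: continuous_cech_incl.
- exact: continuous_char_map.
- by apply/funext => c; exact: cech_val_inj.
move=> Z h k ch ck hk.
(* The mediating map is first described as a relation, shown to be single-valued and total, and then
   extracted by choice. *)
pose R z w := (exists2 y, skel_incl y = z & h y = w) \/ (exists2 c, skel_char c = z & k c = w).
have hkb y c : skel_incl y = skel_char c -> h y = k c.
  move=> /skel_char_bdry[b <- <-].
  by have /(congr1 (fun f => f b)) := hk.
have bdryc c : (exists j, set_val c.1 j = 0) -> exists y, @skel_incl n y = skel_char c.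
  move=> cb; exists (attach (subpt cb, c.2)).
  exact: cech_val_inj.
have Rfun z w w' : R z w -> R z w' -> w = w'.
  (* If either point lies on the boundary, both values of [k] are computed by [h]; otherwise both
     are interior and [char_val_inj] identifies them. *)
  have cc c c' : skel_char c = skel_char c' -> k c = k c'.
    move=> e; have [/bdryc[y ye]|nc] := pselect (exists j, set_val c.1 j = 0).
      by rewrite -(hkb _ _ ye); apply: hkb; rewrite ye.
    have [/bdryc[y ye]|nc'] := pselect (exists j, set_val c'.1 j = 0).
      by rewrite -(hkb _ _ ye); apply/esym; apply: hkb; rewrite ye.
    congr k; apply: char_val_inj.
    - by move=> j; apply/eqP => ?; apply: nc; exists j.
    - by move=> j; apply/eqP => ?; apply: nc'; exists j.
    - exact: (congr1 (@cech_val _ _ _ _) e).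
  move=> [[y <- <-]|[c <- <-]] [[y' e <-]|[c' e <-]].
  - by congr h; apply: cech_val_inj; have /(congr1 (@cech_val _ _ _ _)) := e.
  - exact/hkb/esym.
  - by apply/esym; exact: hkb.
  - exact/cc/esym.
have /choice[u uR] : forall z, exists w, R z w.
  by move=> z; have [[y yz]|[c cz]] := skel_cases z;
    [exists (h y); left; exists y|exists (k c); right; exists c].
have uh y : u (skel_incl y) = h y by apply: (Rfun _ _ _ (uR _)); left; exists y.
have uk c : u (skel_char c) = k c by apply: (Rfun _ _ _ (uR _)); right; exists c.
exists u; split; first split.
(* Cells with at most n + 1 vertices already belong to [skel n], where [u] is [h]; on the others [u]
   is [k] after [cell_lift]. *)
- apply: continuous_from_cech => F dF.
  have [dF'|dF'] := leqP #|` F| n.+1.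
    have cF := @continuous_cell_map _ _ C (fun m => m <= n.+1)%N F dF'.
    rewrite (_ : (fun z => _) = fun z => h (cell_map dF' z)).
      exact: continuous_o cF ch.
    by apply/funext => z; rewrite -uh; congr u; exact: cech_val_inj.
  have eF : #|` F| == n.+2 by rewrite eqn_leq dF dF'.
  have cF := @continuous_cell_lift n.+1 (exist _ F eF).
  rewrite (_ : (fun z => _) = fun z => k (@cell_lift n.+1 (exist _ F eF) z)).
    exact: continuous_o cF ck.
  apply/funext => z; rewrite -uk; congr u; apply: cech_val_inj.
  by apply/esym; exact: (@char_val_lift n.+1 (exist _ F eF)).
- by apply/funext => y; exact: uh.
- by apply/funext => c; exact: uk.
move=> u' [_ u'h u'k]; apply/funext => z.
have [[y <-]|[c <-]] := skel_cases z.
  by rewrite uh; have /(congr1 (fun f => f y)) := u'h.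
by rewrite uk; have /(congr1 (fun f => f c)) := u'k.
Qed.

Lemma skel_colimit : is_seq_colimit skel_incl skel_toX.
Proof.
split.
- by move=> n; exact: continuous_cech_incl.
- by move=> n; apply/funext => x; exact: cech_val_inj.
move=> Z h ch hs.
(* Comparing points by their values in the ambient product avoids transport between the types of
   different skeleta. *)
have hE k : forall n (y : skel n) (y' : skel (k + n)),
    cech_val y = cech_val y' -> h n y = h (k + n)%N y'.
  elim: k => [|k IH] n y y' e; first by rewrite (cech_val_inj e).
  have := @IH n.+1; rewrite addnS => {}IH.
  have <- : h n.+1 (skel_incl y) = h n y by rewrite -(hs n).
  exact: IH.
have hE' n m (y : skel n) (y' : skel m) : cech_val y = cech_val y' -> h n y = h m y'.
  move=> e; have [nm|/ltnW mn] := leqP n m.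
    by move: y' e; rewrite -(subnK nm) => y'; exact: hE.
  by move: y e; rewrite -(subnK mn) => y e; apply/esym; exact: hE.
have surj (z : cech xpredT) : exists n (y : skel n), skel_toX y = z.
  have [F [dF [w ->]]] := cech_cellP z.
  exists #|` F|, (@cell_map _ _ _ (fun m => m <= #|` F|.+1)%N F (leqnSn _) w).
  exact: cech_val_inj.
have /choice[u uR] : forall z : cech xpredT, exists w, exists n (y : skel n),
    skel_toX y = z /\ h n y = w.
  by move=> z; have [n [y yz]] := surj z; exists (h n y), n, y.
have uh n (y : skel n) : u (skel_toX y) = h n y.
  have [m [y' [e <-]]] := uR (skel_toX y); apply: hE'.
  by have /(congr1 (@cech_val _ _ _ _)) := e.
exists u; split; first split.
- apply: continuous_from_cech => F dF.
  have cF := @continuous_cell_map _ _ C (fun m => m <= #|` F|.+1)%N F (leqnSn _).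
  rewrite (_ : (fun z => _) = fun z => h #|` F|
    (@cell_map _ _ _ (fun m => m <= #|` F|.+1)%N F (leqnSn _) z)).
    exact: continuous_o cF (ch _).
  by apply/funext => z; rewrite -uh; congr u; exact: cech_val_inj.
- by move=> n; apply/funext => y; exact: uh.
move=> u' [_ u'h]; apply/funext => z; have [n [y <-]] := surj z.
by rewrite uh -(u'h n).
Qed.

Lemma simplex0_one : simplex 0 (fun=> 1).
Proof. by split => //; rewrite big_ord_recl big_ord0 addr0. Qed.

Lemma skel0_homeomorphic : homeomorphic (faces 0) (skel 0).
Proof.
pose one : set_type (simplex 0) := subpt simplex0_one.
have oneE (t : set_type (simplex 0)) : t = one.
  apply: val_inj; apply/funext => j; have [_] := set_valP t.
  by rewrite big_ord_recl big_ord0 addr0 (ord1 j).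
pose f (c : faces 0) : skel 0 := skel_char (one, c).
have finj : injective f.
  move=> c c' e; have : (one, c) = (one, c').
    by apply: char_val_inj (congr1 (@cech_val _ _ _ _) e) => j; exact: oner_neq0.
  by case.
(* The bound allows the empty F, whose cell has no points; an inhabited cell of [skel 0] is
   therefore a single vertex. *)
have lastE (F : {fset P}) (dF : (#|` F| <= 1)%N) (z : set_type (in_cell F)) :
    #|` F| == 1%N.
  rewrite eqn_leq dF cardfs_gt0; apply/fset0Pn.
  exact: in_cell_neq0 (set_valP z).
have fl (F : {fset P}) (dF : (#|` F| <= 1)%N) (eF : #|` F| == 1%N) z :
    f (@cell_lift 0 (exist _ F eF) z).2 = cell_map dF z.
  apply: cech_val_inj; rewrite -[RHS](@char_val_lift 0 (exist _ F eF)).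
  by rewrite [cell_lift z]surjective_pairing (oneE (cell_lift z).1).
have /choice[g fg] : forall z, exists c, f c = z.
  move=> z; have [F [dF [w ->]]] := cech_cellP z.
  by exists (@cell_lift 0 (exist _ F (lastE F dF w)) w).2; exact: fl.
exists f, g; split => //; last by move=> c; apply: finj; rewrite fg.
  have ci : continuous (fun c : faces 0 => (one, c)).
    by apply: continuous_pair; [exact: continuous_constant|move=> ?; exact: cvg_id].
  by apply: continuous_o ci _; exact: continuous_char_map.
apply: continuous_from_cech => F dF.
have [eF|nF] := boolP (#|` F| == 1%N); last by move=> z; case/negP: nF; exact: lastE z.
rewrite (_ : (fun z => _) = fun z => (@cell_lift 0 (exist _ F eF) z).2).
  have cF := @continuous_cell_lift 0 (exist _ F eF).
  exact: continuous_o cF (@continuous_snd _ _).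
by apply/funext => z; apply: finj; rewrite fg fl.
Qed.

Lemma KW_cech : is_KW_complex (cech xpredT).
Proof.
apply: inhabits.
exact: (@KWStructure (cech xpredT) skel face_idx (@face_space)
  compact_hausdorff_face skel0_homeomorphic attach continuous_attach
  skel_incl (fun n => @skel_char n.+1) skel_pushout skel_toX skel_colimit).
Qed.

End cech_KW.

(** * Pushing to a vertex, and mapping spaces *)

Lemma closed_subtype_image (T : topologicalType) (A : set T) (D : set (set_type A)) :
  closed A -> closed D -> closed [set x | exists2 a, D a & set_val a = x].
Proof.
move=> cA; rewrite -openC => -[O oO OD].
have -> : [set x | exists2 a, D a & set_val a = x] = A `&` ~` O.
  rewrite eqEsubset; split=> x.
    move=> [a Da <-]; split; first exact: set_valP.
    by move=> Oa; have : (~` D) a by rewrite -OD.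
  move=> [Ax nOx]; exists (subpt Ax) => //.
  by apply: contrapT => nD; have : (~` D) (subpt Ax) by []; rewrite -OD.
by apply: closedI => //; exact: open_closedC.
Qed.

Section push.
Variables (Y : topologicalType) (P : choiceType) (C : P -> set Y).
Hypothesis C_closed : forall p, closed (C p).
Variable o : P.

Local Notation B := (Y * {ptws P -> RR})%type.
Local Notation X := (@cech Y P C xpredT).
Local Notation in_cell := (@in_cell Y P C).

(** Clamping makes the push depend on an arbitrary real parameter, so that its curried form is a
    function on all of [RR], a locally compact Hausdorff space. *)
Definition clamp (s : RR) : RR := Num.max 0 (Num.min 1 s).

Lemma clamp_itv s : 0 <= clamp s <= 1.
Proof. by rewrite /clamp le_max lexx ge_max ler01 ge_min lexx. Qed.

Lemma clamp0 : clamp 0 = 0.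
Proof. by rewrite /clamp (min_idPr ler01) maxxx. Qed.

Lemma clamp1 s : 1 <= s -> clamp s = 1.
Proof. by move=> s1; rewrite /clamp (min_idPl s1) (max_idPr ler01). Qed.

Lemma continuous_clamp : continuous clamp.
Proof.
apply: continuous_maxr; first exact: continuous_constant.
by apply: continuous_minr; [exact: continuous_constant|move=> ?; exact: cvg_id].
Qed.

Definition dirac_at : {ptws P -> RR} := fun p => (p == o)%:R.

Definition push_val (z : B) (s : RR) : B :=
  (z.1, (fun p => (1 - clamp s) * z.2 p + clamp s * dirac_at p) : {ptws P -> RR}).

Lemma in_cell_push F z s : C o z.1 -> in_cell F z -> in_cell (o |` F)%fset (push_val z s).
Proof.
move=> Co [h1 h2 h3 h4]; have /andP[s0 s1] := clamp_itv s; split => /=.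
- by move=> p /[!inE] /orP[/eqP->//|]; exact: h1.
- by move=> p; rewrite addr_ge0// mulr_ge0// ?subr_ge0// /dirac_at ler0n.
- move=> p /[!inE]; rewrite negb_or => /andP[/negbTE po pF].
  by rewrite h3// /dirac_at po !mulr0 addr0.
rewrite big_split /= -!mulr_sumr.
(* The old coordinates vanish off F, so their sum over the enlarged face reduces to the sum over F,
   whether or not [o] was already a vertex. *)
rewrite -(big_fset_incl _ (fsubsetU1 o F)); last by move=> p _; exact: h3.
rewrite h4 (big_fsetD1 o) ?fset1U1//= {1}/dirac_at eqxx big_seq big1.
  by rewrite addr0 !mulr1 subrK.
by move=> p; rewrite inE => /andP[/[!inE] /negbTE po _]; rewrite /dirac_at po.
Qed.

Lemma push_points (x : X) s : C o (cech_proj x) -> cech_points C xpredT (push_val (cech_val x) s).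
Proof.
move=> Co; have [F _ Fx] := set_valP (x : set_type _).
by exists (o |` F)%fset => //; exact: in_cell_push.
Qed.

(** Over points outside [C o] the value [x] is a mere default; joint continuity is claimed only
    along maps that stay over [C o]. *)
Definition push (x : X) (s : RR) : X :=
  if pselect (C o (cech_proj x)) is left Co then cech_mk (push_points s Co) else x.

Lemma push_valE x s : C o (cech_proj x) -> cech_val (push x s) = push_val (cech_val x) s.
Proof. by rewrite /push; case: pselect. Qed.

Lemma push0 x : push x 0 = x.
Proof.
have [Co|nC] := pselect (C o (cech_proj x)); last by rewrite /push; case: pselect.
apply: cech_val_inj; rewrite push_valE// /push_val clamp0.
by apply: injective_projections => //=; apply/funext => p; rewrite subr0 mul1r mul0r addr0.
Qed.

Lemma push1 x s : 1 <= s -> C o (cech_proj x) ->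
  cech_val (push x s) = (cech_proj x, dirac_at).
Proof.
move=> s1 Co; rewrite push_valE// /push_val clamp1//.
by congr pair; apply/funext => p; rewrite subrr mul0r add0r mul1r.
Qed.

Lemma push_proj x s : cech_proj (push x s) = cech_proj x.
Proof. by rewrite /push; case: pselect. Qed.

Lemma continuous_push_val (Z : topologicalType) (a : Z -> B) (s : Z -> RR) :
  continuous a -> continuous s -> continuous (fun z => push_val (a z) (s z)).
Proof.
move=> ca cs; have ccs := continuous_o cs continuous_clamp.
apply: continuous_pair; first exact: continuous_o ca (@continuous_fst _ _).
apply: continuous_into_ptws => p; apply: continuous_add; apply: continuous_mul => //.
- by apply: continuous_sub => //; exact: continuous_constant.
- exact: continuous_o ca (@continuous_bary _ _ p).
- exact: continuous_constant.
Qed.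

Lemma continuous_push_cell (Z : topologicalType) (F : {fset P})
    (w : Z -> set_type (in_cell F)) (s : Z -> RR) :
  continuous w -> continuous s -> (forall z, C o (set_val (w z)).1) ->
  continuous (fun z => push (@cell_map _ _ _ xpredT F isT (w z)) (s z)).
Proof.
move=> cw cs Co; apply: (continuous_into_cech C_closed (Fs := [:: (o |` F)%fset])).
  rewrite (_ : (fun z => _) = fun z => push_val (set_val (w z)) (s z)).
    by apply: continuous_push_val => //; exact: continuous_o cw (@continuous_set_val _ _).
  by apply/funext => z; rewrite push_valE//; exact: Co.
move=> z; exists (o |` F)%fset; first by rewrite inE.
split => //; rewrite push_valE; last exact: Co.
by apply: in_cell_push; [exact: Co|exact: (set_valP (w z))].
Qed.

(* The product of a colimit with the locally compact space RR is again a colimit: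
   continuity is checked cell by cell after currying into the compact-open topology. *)
Lemma continuous_push (Z : topologicalType) (a : Z -> X) (s : Z -> RR) :
  continuous a -> continuous s -> (forall z, C o (cech_proj (a z))) ->
  continuous (fun z => push (a z) (s z)).
Proof.
move=> ca cs Co.
pose g : X -> {compact-open, RR -> X} := push.
have cg1 x : continuous (push x).
  have [Cx|nC] := pselect (C o (cech_proj x)); last first.
    rewrite (_ : push x = fun=> x); first exact: continuous_constant.
    by apply/funext => r; rewrite /push; case: pselect.
  have [F [dF [w xE]]] := cech_cellP x.
  rewrite xE (_ : dF = isT); last exact: bool_irrelevance.
  apply: (@continuous_push_cell RR F (fun=> w) (fun r => r)).
  - exact: continuous_constant.
  - by move=> ?; exact: cvg_id.
  - by move=> _; rewrite xE in Cx.
have cga : continuous (fun z => g (a z)).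
  apply/continuous_closedP => D cD.
  (* Because of the default value, [g] may fail to be continuous on the whole nerve. As [a] stays
     over the closed set [C o], it is enough that the part of the preimage of D over [C o] is
     closed, and this can be checked in each cell. *)
  have -> : (fun z => g (a z)) @^-1` D = a @^-1` [set x | C o (cech_proj x) /\ D (g x)].
    by rewrite eqEsubset; split=> z /= => [|[]//]; split.
  apply: closed_preimage => //; apply/cech_closedP => F dF.
  pose S : set (set_type (in_cell F)) := [set w | C o (set_val w).1].
  have cS : closed S.
    apply: (closed_preimage (f := fun w : set_type (in_cell F) => (set_val w).1)) => //.
    exact: continuous_o (@continuous_set_val _ _) (@continuous_fst _ _).
  have cgS : continuous (fun w : set_type S => g (cell_map dF (set_val w))).
    have : continuous (fun q : set_type S * RR => push (cell_map dF (set_val q.1)) q.2).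
      rewrite (_ : dF = isT); last exact: bool_irrelevance.
      apply: continuous_push_cell.
      - exact: continuous_o (@continuous_fst _ _) (@continuous_set_val _ _).
      - exact: continuous_snd.
      - by move=> q; exact: (set_valP q.1).
    by move=> /continuous_curry_fun.
  have := closed_subtype_image cS (closed_preimage cgS cD).
  congr closed; rewrite eqEsubset; split=> w /=.
    by move=> [v Dv <-]; split => //; exact: (set_valP v).
  by move=> [Cw Dw]; exists (subpt (Cw : S w)).
(* Here local compactness of [RR] turns the curried statement back into joint continuity. *)
have cu : continuous (uncurry (fun z => g (a z)) : Z * RR -> X).
  apply: continuous_uncurry.
  - exact: (@locally_compactR RR).
  - exact: Rhausdorff.
  - exact: cga.
  - by move=> z; exact: (cg1 (a z)).
have ci : continuous (fun z : Z => z) by move=> ?; exact: cvg_id.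
exact: continuous_o (continuous_pair ci cs) cu.
Qed.

End push.

(** * Mapping spaces and the exponential law *)

Section mapping_spaces.
Variable K : topologicalType.
Hypothesis hK : compact_hausdorff K.

Definition ev (X : topologicalType) (g : Map K X) : K -> X :=
  sval (g : set_type (@cmaps K X)).

Lemma ev_inj (X : topologicalType) : injective (@ev X).
Proof. by move=> g h e; exact: val_inj. Qed.

Lemma continuous_ev (X : topologicalType) (g : Map K X) : continuous (ev g).
Proof. exact: (set_valP (g : set_type (@cmaps K X))). Qed.

Definition mkMap (X : topologicalType) (f : K -> X) (cf : continuous f) : Map K X :=
  @subpt _ (@cmaps K X) f cf.

Lemma locally_compact_compact : locally_compact [set: K].
Proof.
move=> x _; rewrite withinET; exists setT; first exact: filterT.
by split; [exact: hK.1|exact: closedT].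
Qed.

Lemma kify_id_continuous (T : topologicalType) : continuous (fun x : kify T => (x : T)).
Proof.
apply/continuousP => A oA; suff kA : kopen A by exact: kA.
by move=> L u hL /continuousP; exact.
Qed.

Lemma continuous_into_kify (L T : topologicalType) (f : L -> T) :
  compact_hausdorff L -> continuous f -> continuous (f : L -> kify T).
Proof.
by move=> hL cf; apply/continuousP => A oA; have kA : @kopen T A := oA; exact: kA.
Qed.

(** Passing to [kify] does not affect continuity of maps out of a compact Hausdorff space, so on
    such a D the exponential law of the compact-open topology applies; uncurrying uses that K is
    locally compact. *)
Lemma continuous_Map (T : topologicalType) (D : set T) (X : topologicalType)
    (g : T -> Map K X) :
  compact_hausdorff (set_type D) ->
  {within D, continuous g} <->
  continuous (fun q : set_type D * K => ev (g (set_val q.1)) q.2).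
Proof.
move=> hD; split=> [/subspace_sigL_continuousP cg|cg].
  rewrite (_ : (fun q => _) = uncurry (fun d : set_type D => ev (g (set_val d)))); last first.
    by apply/funext => -[].
  apply: continuous_uncurry.
  - exact: locally_compact_compact.
  - exact: hK.2.
  - apply: continuous_o (@continuous_set_val _ (@cmaps K X)).
    exact: continuous_o cg (@kify_id_continuous _).
  - by move=> d; exact: continuous_ev.
apply/subspace_sigL_continuousP; apply: continuous_into_kify => //.
by apply: continuous_into_subtype; exact: continuous_curry_fun cg.
Qed.

(** Openness in the source is tested along maps from compact Hausdorff spaces L. On these the map is
    curried from [f] composed with a continuous map on L x K. *)
Lemma continuous_postcomp (X Z : topologicalType) (f : X -> Z) (hf : continuous f) :
  continuous (@postcomp K X Z f hf).
Proof.
apply/continuousP => A oA.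
suff kA : @kopen (set_type (@cmaps K X)) (@postcomp K X Z f hf @^-1` A) by exact: kA.
move=> L u hL cu; have cpu : continuous (fun l => @postcomp K X Z f hf (u l)).
  apply: continuous_into_kify => //; apply: continuous_into_subtype.
  have cu' : {within [set: L], continuous (u : L -> Map K X)}.
    by apply: continuous_subspaceT; exact: continuous_into_kify.
  move/continuous_Map : cu' => cu'.
  have hT : compact_hausdorff (set_type [set: L]).
    by apply: compact_hausdorff_closed => //; exact: closedT.
  have cL : continuous (fun l : L => subpt (I : [set: L] l)).
    by apply: continuous_into_subtype => ?; exact: cvg_id.
  have c2 : continuous (fun q : L * K => (subpt (I : [set: L] q.1), q.2)).
    apply: continuous_pair; last exact: continuous_snd.
    exact: continuous_o (@continuous_fst _ _) cL.
  exact: continuous_curry_fun (continuous_o (continuous_o c2 (cu' hT)) hf).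
by move/continuousP : cpu; exact.
Qed.

End mapping_spaces.

(** * Lifting maps from a disk *)

Lemma continuous_inv (Z : topologicalType) (f : Z -> RR) :
  (forall z, f z != 0) -> continuous f -> continuous (fun z => (f z)^-1).
Proof. by move=> f0 cf z; exact: (@cvgV RR Z _ _ f _ (f0 z) (cf z)). Qed.

Lemma continuous_abs (Z : topologicalType) (f : Z -> RR) :
  continuous f -> continuous (fun z => `|f z|).
Proof. by move=> cf z; exact: (@cvg_norm RR RR^o Z _ _ f _ (cf z)). Qed.

Lemma within_comp (A B C : topologicalType) (D : set A) (E : set B)
    (f : A -> B) (g : B -> C) :
  continuous f -> (forall x, D x -> E (f x)) -> {within E, continuous g} ->
  {within D, continuous (fun x => g (f x))}.
Proof.
move=> cf DE /subspace_sigL_continuousP cg; apply/subspace_sigL_continuousP.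
have cl : continuous (fun x : set_type D => subpt (DE _ (set_valP x))).
  by apply: continuous_into_subtype; exact: continuous_o (@continuous_set_val _ _) cf.
exact: continuous_o cl cg.
Qed.

Lemma within_eq (A B : topologicalType) (D : set A) (f g : A -> B) :
  (forall x, D x -> f x = g x) -> {within D, continuous f} -> {within D, continuous g}.
Proof. by move=> fg; apply: subspace_eq_continuous => x /set_mem; exact: fg. Qed.

(* A star-shaped neighbourhood: [sc] scales about a centre and [m] is the gauge of the disk. *)
Record disk_gauge (T : topologicalType) (m : T -> RR) (sc : RR * T -> T) : Prop := {
  gauge_hausdorff : hausdorff_space T;
  gauge_compact : compact [set q | m q <= 1];
  gauge_continuous : continuous m;
  scale_continuous : continuous sc;
  gauge_scale : forall c q, 0 <= c -> m (sc (c, q)) = c * m q;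
  scale1 : forall q, sc (1, q) = q
}.

(** The factor is 2 where the gauge is at most 1/2, so [collar] stretches the inner half disk over
    the whole disk; beyond that it is the inverse of the gauge, which projects the collar radially
    to the sphere. *)
Definition collar_factor (T : Type) (m : T -> RR) (q : T) : RR := (Num.max (1 / 2) (m q))^-1.

Definition collar (T : Type) (m : T -> RR) (sc : RR * T -> T) (q : T) : T :=
  sc (collar_factor m q, q).

Section collar_theory.
Variables (T : topologicalType) (m : T -> RR) (sc : RR * T -> T).
Hypothesis G : disk_gauge m sc.

Let max_gt0 q : 0 < Num.max (1 / 2) (m q).
Proof. by rewrite lt_max; apply/orP; left; lra. Qed.

Lemma collar_factor_ge0 q : 0 <= collar_factor m q.
Proof. by rewrite invr_ge0 ltW. Qed.

Lemma collar_factor_le1 q : collar_factor m q * m q <= 1.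
Proof. by rewrite /collar_factor mulrC ler_pdivrMr// [leRHS]mul1r le_max lexx orbT. Qed.

Lemma continuous_collar_factor : continuous (collar_factor m).
Proof.
apply: continuous_inv; first by move=> q; rewrite gt_eqF.
by apply: continuous_maxr; [exact: continuous_constant|exact: gauge_continuous G].
Qed.

Lemma continuous_collar : continuous (collar m sc).
Proof.
have ci : continuous (fun q : T => q) by move=> ?; exact: cvg_id.
exact: continuous_o (continuous_pair continuous_collar_factor ci) (scale_continuous G).
Qed.

Lemma collar_disk q : m (collar m sc q) <= 1.
Proof. by rewrite (gauge_scale G) ?collar_factor_ge0// collar_factor_le1. Qed.

Lemma collar_outer q : 1 / 2 <= m q -> m (collar m sc q) = 1.
Proof.
move=> mq; rewrite (gauge_scale G) ?collar_factor_ge0// /collar_factor (max_idPr mq).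
by rewrite mulVf//; apply/eqP => m0; move: mq; rewrite m0; lra.
Qed.

Lemma collar_factor_sphere q : m q = 1 -> collar_factor m q = 1.
Proof. by move=> mq; rewrite /collar_factor mq (max_idPr _) ?invr1//; lra. Qed.

Lemma collar_sphere q : m q = 1 -> collar m sc q = q.
Proof. by move=> mq; rewrite /collar collar_factor_sphere// (scale1 G). Qed.

Lemma compact_hausdorff_closed_disk (D : set T) :
  closed D -> (forall q, D q -> m q <= 1) -> compact_hausdorff (set_type D).
Proof.
move=> cD sub; split.
  by apply: compact_subtype; exact: subclosed_compact cD (gauge_compact G) sub.
apply: (hausdorff_inj (f := fun x : set_type D => set_val x)).
- exact: continuous_set_val.
- exact: val_inj.
- exact: gauge_hausdorff G.
Qed.

(** Interpolates linearly between the scaling factors [collar_factor] and 1; this is a homotopy from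
    [collar] to the identity, within the disk and fixed on the sphere. *)
Definition collar_shrink (p : RR * T) : T :=
  sc ((1 - p.1) * collar_factor m p.2 + p.1, p.2).

Lemma continuous_collar_shrink : continuous collar_shrink.
Proof.
have cp : continuous (fun p : RR * T => ((1 - p.1) * collar_factor m p.2 + p.1, p.2)).
  apply: continuous_pair; last exact: continuous_snd.
  apply: continuous_add; last exact: continuous_fst.
  apply: continuous_mul.
    by apply: continuous_sub; [exact: continuous_constant|exact: continuous_fst].
  exact: continuous_o (@continuous_snd _ _) continuous_collar_factor.
exact: continuous_o cp (scale_continuous G).
Qed.

Lemma collar_shrink_disk t q : 0 <= t <= 1 -> m q <= 1 -> m (collar_shrink (t, q)) <= 1.
Proof.
move=> /andP[t0 t1] mq; have r0 := collar_factor_ge0 q; have r1 := collar_factor_le1 q.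
rewrite /collar_shrink /= (gauge_scale G); last by rewrite addr_ge0// mulr_ge0// subr_ge0.
rewrite mulrDl -mulrA.
have h1 : (1 - t) * (collar_factor m q * m q) <= 1 - t by rewrite ler_piMr// subr_ge0.
have h2 : t * m q <= t by rewrite ler_piMr.
by rewrite -[leRHS](subrK t) lerD.
Qed.

Lemma collar_shrink0 q : collar_shrink (0, q) = collar m sc q.
Proof. by rewrite /collar_shrink /= subr0 mul1r addr0. Qed.

Lemma collar_shrink1 q : collar_shrink (1, q) = q.
Proof. by rewrite /collar_shrink /= subrr mul0r add0r (scale1 G). Qed.

Lemma collar_shrink_sphere t q : m q = 1 -> collar_shrink (t, q) = q.
Proof.
by move=> mq; rewrite /collar_shrink /= collar_factor_sphere// mulr1 subrK (scale1 G).
Qed.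

End collar_theory.

(** The lift extends [a] exactly but covers [b] only after [collar]; the collar is the room in which
    the boundary values are deformed with their projection held constant. *)
Definition disk_lifting (M N : topologicalType) (phi : M -> N) : Prop :=
  forall (T : topologicalType) (m : T -> RR) (sc : RR * T -> T), disk_gauge m sc ->
  forall (a : T -> M) (b : T -> N),
    {within [set q | m q = 1], continuous a} ->
    {within [set q | m q <= 1], continuous b} ->
    (forall q, m q = 1 -> phi (a q) = b q) ->
  exists c : T -> M, [/\ {within [set q | m q <= 1], continuous c},
    forall q, m q = 1 -> c q = a q &
    forall q, m q <= 1 -> phi (c q) = b (collar m sc q)].

Section lifting.
Variables (Y : topologicalType) (P : choiceType) (C : P -> set Y).
Hypothesis C_closed : forall p, closed (C p).
Hypothesis C_cpt : forall p, compact_hausdorff (set_type (C p)).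
Hypothesis C_cover : forall (L : topologicalType) (u : L -> Y),
  compact_hausdorff L -> continuous u -> exists p, forall l, C p (u l).
Variable K : topologicalType.
Hypothesis hK : compact_hausdorff K.

Local Notation X := (@cech Y P C xpredT).
Local Notation B := (Y * {ptws P -> RR})%type.

Definition cech_map : Map K X -> Map K Y :=
  @postcomp K X Y (@cech_proj Y P C xpredT) (@continuous_cech_proj Y P C xpredT).

Lemma in_cell_cone p (y : Y) : C p y -> in_cell C [fset p]%fset (y, dirac_at p).
Proof.
move=> Cy; split => /=.
- by move=> q /[!inE] /eqP ->.
- by move=> q; rewrite /dirac_at ler0n.
- by move=> q /[!inE] /negbTE qp; rewrite /dirac_at qp.
- by rewrite big_seq_fset1 /dirac_at eqxx.
Qed.

Definition cone p (y : Y) (Cy : C p y) : X :=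
  cech_mk (ex_intro2 (fun F : {fset P} => xpredT #|` F|)
    (fun F => in_cell C F (y, dirac_at p)) _ isT (in_cell_cone Cy)).

Lemma continuous_to_cone p (Z : topologicalType) (phi : Z -> X) (y : Z -> Y) :
  continuous y -> (forall z, C p (y z)) ->
  (forall z, cech_val (phi z) = (y z, dirac_at p)) -> continuous phi.
Proof.
move=> cy Cy phiE; apply: (continuous_into_cech C_closed (Fs := [:: [fset p]%fset])).
  rewrite (_ : (fun z => _) = fun z => (y z, dirac_at p)); last exact/funext.
  by apply: continuous_pair => //; exact: continuous_constant.
move=> z; exists [fset p]%fset; first by rewrite inE.
by split => //; rewrite phiE; exact: in_cell_cone.
Qed.

Lemma cech_map_surj (b : Map K Y) : exists a, cech_map a = b.
Proof.
have [p Cp] := C_cover hK (continuous_ev (g := b)).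
have cc : continuous (fun k => cone (Cp k)).
  exact: (continuous_to_cone (continuous_ev (g := b)) Cp).
by exists (mkMap cc); apply: ev_inj; apply/funext.
Qed.

Lemma cech_map_disk_lifting : disk_lifting cech_map.
Proof.
move=> T m sc G a b ca cb ab.
have cm := gauge_continuous G.
have cD : closed [set q | m q <= 1].
  by apply: closed_le_fun => //; exact: continuous_constant.
have cS : closed [set q | m q = 1].
  by apply: closed_eq_fun => //; exact: continuous_constant.
have hD : compact_hausdorff (set_type [set q | m q <= 1]).
  exact: (compact_hausdorff_closed_disk G cD (fun q h => h)).
have hS : compact_hausdorff (set_type [set q | m q = 1]).
  by apply: (compact_hausdorff_closed_disk G cS) => q /= ->.
move/(continuous_Map _ _ hD) : cb => cb; move/(continuous_Map _ _ hS) : ca => ca.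
have [p Cp] := C_cover (compact_hausdorff_prod hD hK) (cb hK).
have {}Cp q k : m q <= 1 -> C p (ev (b q) k).
  by move=> mq; exact: (Cp (subpt (mq : [set q | m q <= 1] q), k)).
have Ca q k : m q = 1 -> C p (cech_proj (ev (a q) k)).
  move=> mq; have <- : ev (b q) k = cech_proj (ev (a q) k) by rewrite -(ab q mq).
  by apply: Cp; rewrite mq.
pose r := collar m sc.
(* The parameter [2 * (1 - m)] is 0 on the sphere, where the push does nothing, and 1 at gauge 1/2.
   There the pushed point is the vertex [p] over the projection of [a (r q)], which equals
   [b (r q)], so both prescriptions agree. *)
have /choice[c0 c0P] : forall qk : T * K, exists e : X,
    (m qk.1 <= 1 / 2 -> cech_val e = (ev (b (r qk.1)) qk.2, dirac_at p)) /\
    (1 / 2 <= m qk.1 -> e = push p (ev (a (r qk.1)) qk.2) (2 * (1 - m qk.1))).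
  move=> [q k] /=; have [mq|mq] := leP (m q) (1 / 2); last first.
    exists (push p (ev (a (r q)) k) (2 * (1 - m q))); split => //.
  exists (cone (Cp (r q) k (collar_disk G q))); split => // mq'.
  apply: cech_val_inj => /=; have rq := collar_outer G mq'.
  rewrite push1; [|lra|exact: Ca].
  transitivity (ev (b (r q)) k, dirac_at p); first by [].
  by rewrite -(ab _ rq).
have c0in qk : m qk.1 <= 1 / 2 -> cech_val (c0 qk) = (ev (b (r qk.1)) qk.2, dirac_at p).
  by case: (c0P qk).
have c0out qk : 1 / 2 <= m qk.1 -> c0 qk = push p (ev (a (r qk.1)) qk.2) (2 * (1 - m qk.1)).
  by case: (c0P qk).
pose D1 : set T := [set q | m q <= 1 / 2].
pose D2 : set T := [set q | 1 / 2 <= m q] `&` [set q | m q <= 1].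
have cD1 : closed D1 by apply: closed_le_fun => //; exact: continuous_constant.
have cD2 : closed D2.
  by apply: closedI => //; apply: closed_le_fun => //; exact: continuous_constant.
have hD1 : compact_hausdorff (set_type D1).
  by apply: (compact_hausdorff_closed_disk G cD1) => q; rewrite /D1 /=; lra.
have hD2 : compact_hausdorff (set_type D2).
  by apply: (compact_hausdorff_closed_disk G cD2) => q [].
have DE : [set q | m q <= 1] = D1 `|` D2.
  rewrite eqEsubset; split=> q /=.
    by move=> mq; have [h|/ltW h] := leP (m q) (1 / 2); [left|right; split].
  by move=> [|[]//]; rewrite /D1 /=; lra.
have c1 : continuous (fun q : set_type D1 * K => c0 (set_val q.1, q.2)).
  have cv : continuous (fun q : set_type D1 * K => set_val q.1).
    exact: continuous_o (@continuous_fst _ _) (@continuous_set_val _ _).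
  apply: (@continuous_to_cone p _ _ (fun q => ev (b (r (set_val q.1))) q.2)).
  - have cl : continuous (fun q : set_type D1 * K =>
        (subpt (collar_disk G (set_val q.1) : [set q | m q <= 1] _), q.2)).
      apply: continuous_pair; last exact: continuous_snd.
      apply: continuous_into_subtype.
      exact: continuous_o cv (continuous_collar G).
    exact: continuous_o cl (cb hK).
  - by move=> q; apply: Cp; exact: (collar_disk G).
  - by move=> q; apply: c0in; exact: (set_valP q.1).
have c2 : continuous (fun q : set_type D2 * K => c0 (set_val q.1, q.2)).
  have half (q : set_type D2) : 1 / 2 <= m (set_val q) by case: (set_valP q).
  rewrite (_ : (fun q => _) = fun q : set_type D2 * K =>
    push p (ev (a (r (set_val q.1))) q.2) (2 * (1 - m (set_val q.1)))); last first.
    by apply/funext => q; rewrite c0out//; exact: half.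
  have cv : continuous (fun q : set_type D2 * K => set_val q.1).
    exact: continuous_o (@continuous_fst _ _) (@continuous_set_val _ _).
  apply: continuous_push => //.
  - have cl : continuous (fun q : set_type D2 * K =>
        (subpt (collar_outer G (half q.1) : [set q | m q = 1] _), q.2)).
      apply: continuous_pair; last exact: continuous_snd.
      apply: continuous_into_subtype.
      exact: continuous_o cv (continuous_collar G).
    exact: continuous_o cl (ca hK).
  - apply: continuous_mul; first exact: continuous_constant.
    apply: continuous_sub; first exact: continuous_constant.
    exact: continuous_o cv cm.
  - by move=> q; apply: Ca; exact: (collar_outer G (half q.1)).
have cq q : m q <= 1 -> continuous (fun k => c0 (q, k)).
  move=> mq; have : (D1 `|` D2) q by rewrite -DE.
  by case=> Dq; [have ck := c1|have ck := c2];
    apply: (continuous_o (f := fun k => (subpt Dq, k))) ck;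
    (apply: continuous_pair; [exact: continuous_constant|move=> ?; exact: cvg_id]).
(* A point of [Map K X] contains a continuity proof, available for q in the disk; outside it [a q]
   is a default. *)
pose c q : Map K X := if pselect (continuous (fun k => c0 (q, k))) is left h
  then mkMap h else a q.
have cE q k : m q <= 1 -> ev (c q) k = c0 (q, k).
  by move=> /cq h; rewrite /c; case: pselect.
exists c; split.
- rewrite DE; apply: withinU_continuous => //; apply/continuous_Map => //.
    rewrite (_ : (fun q => _) = fun q : set_type D1 * K => c0 (set_val q.1, q.2)) //.
    by apply/funext => q; rewrite cE//; have := set_valP q.1; rewrite /D1 /=; lra.
  rewrite (_ : (fun q => _) = fun q : set_type D2 * K => c0 (set_val q.1, q.2)) //.
  by apply/funext => q; rewrite cE//; case: (set_valP q.1).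
- move=> q mq; apply: ev_inj; apply/funext => k; rewrite cE ?mq//.
  rewrite c0out /= ?mq; last by lra.
  by rewrite subrr mulr0 push0 /r (collar_sphere G).
- move=> q mq; apply: ev_inj; apply/funext => k.
  rewrite [LHS](_ : _ = cech_proj (ev (c q) k)) // cE//.
  have [h|/ltW h] := leP (m q) (1 / 2); first by rewrite /cech_proj c0in.
  by rewrite c0out// push_proj -(ab _ (collar_outer G h)).
Qed.

End lifting.

(** * Weak equivalence *)

Section gauges.

(** The distance to the midpoint 1/2, normalised so that the unit interval is the unit ball and its
    endpoints are the unit sphere. *)
Definition interval_gauge (t : RR) : RR := `|2 * t - 1|.
Definition interval_scale (p : RR * RR) : RR := 1 / 2 + p.1 * (p.2 - 1 / 2).

(** The sup norm about the centre of the cube. The cylinder below receives the same norm with one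
    more coordinate, so its sphere consists of the two ends and the side. *)
Definition cube_gauge n (x : Rn n) : RR := \big[Num.max/0]_(i < n) interval_gauge (x i).
Definition cube_scale n (p : RR * Rn n) : Rn n := fun i => interval_scale (p.1, p.2 i).

Definition cylinder_gauge n (q : RR * Rn n) : RR :=
  Num.max (interval_gauge q.1) (cube_gauge q.2).
Definition cylinder_scale n (p : RR * (RR * Rn n)) : RR * Rn n :=
  (interval_scale (p.1, p.2.1), cube_scale (p.1, p.2.2)).

Lemma interval_gauge_le1 t : (interval_gauge t <= 1) = (0 <= t <= 1).
Proof.
rewrite /interval_gauge ler_norml; apply/andP/andP => -[h1 h2]; split; lra.
Qed.

Lemma interval_gauge_eq1 t : interval_gauge t = 1 <-> t = 0 \/ t = 1.
Proof.
rewrite /interval_gauge; split=> [|[->|->]]; last 2 first.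
- by rewrite mulr0 sub0r normrN normr1.
- by rewrite mulr1 [_ - _](_ : _ = 1) ?normr1//; lra.
by move=> /eqP; rewrite eqr_norml => /andP[/orP[/eqP h|/eqP h] _]; [right|left]; lra.
Qed.

Lemma interval_gauge_scale c t :
  0 <= c -> interval_gauge (interval_scale (c, t)) = c * interval_gauge t.
Proof.
move=> c0; rewrite /interval_gauge /interval_scale /= -[c in RHS]ger0_norm// -normrM.
by congr `|_|; lra.
Qed.

Lemma interval_scale1 t : interval_scale (1, t) = t.
Proof. by rewrite /interval_scale /=; lra. Qed.

Lemma continuous_interval_gauge : continuous interval_gauge.
Proof.
apply: continuous_abs; apply: continuous_sub; last exact: continuous_constant.
by apply: continuous_mul; [exact: continuous_constant|move=> ?; exact: cvg_id].
Qed.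

Lemma continuous_interval_scale : continuous interval_scale.
Proof.
apply: continuous_add; first exact: continuous_constant.
apply: continuous_mul; first exact: continuous_fst.
by apply: continuous_sub; [exact: continuous_snd|exact: continuous_constant].
Qed.

Lemma unit_intervalE : unit_interval = [set t | interval_gauge t <= 1].
Proof. by rewrite eqEsubset; split=> t; rewrite /unit_interval /= interval_gauge_le1. Qed.

Lemma compact_unit_interval : compact unit_interval.
Proof.
have -> : unit_interval = `[0, 1]%classic.
  by rewrite eqEsubset; split => x; rewrite /unit_interval /= in_itv.
exact: segment_compact.
Qed.

Lemma disk_gauge_interval : disk_gauge interval_gauge interval_scale.
Proof.
split.
- exact: Rhausdorff.
- by rewrite -unit_intervalE; exact: compact_unit_interval.
- exact: continuous_interval_gauge.
- exact: continuous_interval_scale.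
- exact: interval_gauge_scale.
- exact: interval_scale1.
Qed.

Lemma cubeE n : cube n = [set x | cube_gauge x <= 1].
Proof.
rewrite eqEsubset; split=> x /= h.
  by apply: bigmax_le => // i _; rewrite interval_gauge_le1; exact: h.
move=> i; rewrite -interval_gauge_le1; apply: le_trans h.
exact: (le_bigmax _ (fun i => interval_gauge (x i))).
Qed.

Lemma cube_bdryE n : cube_bdry n = [set x | cube_gauge x = 1].
Proof.
rewrite eqEsubset; split=> x /=.
  move=> [cx [i /interval_gauge_eq1 xi]]; apply/eqP; rewrite eq_le.
  rewrite cubeE in cx; rewrite cx /= -xi.
  exact: (le_bigmax _ (fun i => interval_gauge (x i))).
move=> x1; have cx : cube n x by rewrite cubeE /= x1.
split => //; apply: contrapT => nx; suff : cube_gauge x < 1 by rewrite x1 ltxx.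
apply: bigmax_lt => // i _; rewrite lt_neqAle interval_gauge_le1 cx andbT.
by apply/eqP => /interval_gauge_eq1 xi; apply: nx; exists i.
Qed.

Lemma cube_gauge_scale n c (x : Rn n) :
  0 <= c -> cube_gauge (cube_scale (c, x)) = c * cube_gauge x.
Proof.
move=> c0; rewrite /cube_gauge; apply: (big_ind2 (fun a b => a = c * b)).
- by rewrite mulr0.
- by move=> a b a' b' -> ->; rewrite maxr_pMr.
- by move=> i _; exact: interval_gauge_scale.
Qed.

Lemma cube_scale1 n (x : Rn n) : cube_scale (1, x) = x.
Proof. by apply/funext => i; exact: interval_scale1. Qed.

Lemma continuous_cube_gauge n : continuous (@cube_gauge n).
Proof.
rewrite /cube_gauge; elim: (index_enum _) => [|i s IH].
  rewrite (_ : (fun _ => _) = fun=> 0); first exact: continuous_constant.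
  by apply/funext => z; rewrite big_nil.
rewrite (_ : (fun _ => _) = fun x : Rn n =>
  Num.max (interval_gauge (x i)) (\big[Num.max/0]_(i <- s) interval_gauge (x i))).
  apply: continuous_maxr => //.
  exact: continuous_o (@continuous_ptws_eval RR _ i) continuous_interval_gauge.
by apply/funext => x; rewrite big_cons.
Qed.

Lemma continuous_cube_scale n : continuous (@cube_scale n).
Proof.
apply: continuous_into_ptws => i.
have c1 : continuous (fun p : RR * Rn n => (p.1, p.2 i)).
  apply: continuous_pair; first exact: continuous_fst.
  exact: continuous_o (@continuous_snd _ _) (@continuous_ptws_eval RR _ i).
exact: continuous_o c1 continuous_interval_scale.
Qed.

Lemma compact_cube n : compact (cube n).
Proof. exact: (@tychonoff 'I_n (fun=> RR) (fun=> unit_interval) (fun=> compact_unit_interval)). Qed.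

Lemma hausdorff_Rn n : hausdorff_space (Rn n).
Proof. by apply: (@hausdorff_product 'I_n (fun=> RR)) => _; exact: Rhausdorff. Qed.

Lemma disk_gauge_cube n : disk_gauge (@cube_gauge n) (@cube_scale n).
Proof.
split.
- exact: hausdorff_Rn.
- by rewrite -cubeE; exact: compact_cube.
- exact: continuous_cube_gauge.
- exact: continuous_cube_scale.
- by move=> c q; exact: cube_gauge_scale.
- exact: cube_scale1.
Qed.

Lemma cylinderE n : cylinder n = [set q | cylinder_gauge q <= 1].
Proof.
rewrite eqEsubset; split=> q; rewrite /cylinder /= unit_intervalE cubeE /cylinder_gauge ge_max.
  by move=> [/= -> ->].
by move=> /andP[].
Qed.

Lemma cylinder_gauge_eq1 n (q : RR * Rn n) : cylinder_gauge q = 1 ->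
  [\/ q.1 = 0 /\ cube n q.2, q.1 = 1 /\ cube n q.2 |
      unit_interval q.1 /\ cube_bdry n q.2].
Proof.
move=> q1; have : cylinder n q by rewrite cylinderE /= q1.
move=> [tq cq]; move: q1; rewrite /cylinder_gauge /Num.max.
case: ifP => _; first by move=> q1; apply: Or33; rewrite cube_bdryE.
by move=> /interval_gauge_eq1[t0|t1]; [apply: Or31|apply: Or32].
Qed.

Lemma cylinder_gauge_end n (q : RR * Rn n) :
  (q.1 = 0 \/ q.1 = 1) -> cube n q.2 -> cylinder_gauge q = 1.
Proof.
move=> /interval_gauge_eq1 q1; rewrite cubeE /= => cq.
by rewrite /cylinder_gauge q1; apply/max_idPl.
Qed.

Lemma cylinder_gauge_side n (q : RR * Rn n) :
  unit_interval q.1 -> cube_bdry n q.2 -> cylinder_gauge q = 1.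
Proof.
rewrite unit_intervalE cube_bdryE /= => q1 cq.
by rewrite /cylinder_gauge cq; apply/max_idPr.
Qed.

Lemma disk_gauge_cylinder n : disk_gauge (@cylinder_gauge n) (@cylinder_scale n).
Proof.
split.
- by apply: hausdorff_prod; [exact: Rhausdorff|exact: hausdorff_Rn].
- rewrite -cylinderE.
  have -> : cylinder n = unit_interval `*` cube n by [].
  by apply: compact_setX; [exact: compact_unit_interval|exact: compact_cube].
- apply: continuous_maxr.
    exact: continuous_o (@continuous_fst _ _) continuous_interval_gauge.
  exact: continuous_o (@continuous_snd _ _) (@continuous_cube_gauge n).
- have cp (A : topologicalType) (f : RR * Rn n -> A) : continuous f ->
      continuous (fun p : RR * (RR * Rn n) => (p.1, f p.2)).
    move=> cf; apply: continuous_pair; first exact: continuous_fst.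
    exact: continuous_o (@continuous_snd _ _) cf.
  apply: continuous_pair.
    exact: continuous_o (cp _ _ (@continuous_fst _ _)) continuous_interval_scale.
  exact: continuous_o (cp _ _ (@continuous_snd _ _)) (@continuous_cube_scale n).
- move=> c q c0; rewrite /cylinder_gauge /= interval_gauge_scale// cube_gauge_scale//.
  by rewrite maxr_pMr.
- by move=> [t x]; rewrite /cylinder_scale /= interval_scale1 cube_scale1.
Qed.

End gauges.

(** Injectivity on path components is lifting on the interval, surjectivity on homotopy groups
    lifting on cubes, and injectivity lifting on cylinders. Both injectivity statements need only
    the boundary values of the lift; surjectivity also uses the deformation of [collar] to the
    identity. *)
Lemma disk_lifting_weak_equivalence (M N : topologicalType) (phi : M -> N) :
  continuous phi -> (forall b, exists a, phi a = b) -> disk_lifting phi ->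
  weak_homotopy_equivalence M N phi.
Proof.
move=> cphi surj lift.
have path_refl (T : topologicalType) (x : T) : path_joined x x.
  exists (fun=> x); split => //.
  by apply: continuous_subspaceT; exact: continuous_constant.
have cl1 (A : topologicalType) (f : A -> RR) (r : RR) :
    continuous f -> closed [set x | f x = r].
  by move=> cf; apply: closed_eq_fun => //; exact: continuous_constant.
split => //.
- by move=> b; have [a <-] := surj b; exists a.
- move=> a a' [p [cp p0 p1]].
  have [|||c [cc ce _]] := lift _ _ _ disk_gauge_interval
      (fun t => if t == 0 then a else a') p.
  + have -> : [set q | interval_gauge q = 1] = [set q | q = 0] `|` [set q | q = 1].
      by rewrite eqEsubset; split=> t /interval_gauge_eq1.
    have cidR : continuous (fun t : RR => t) by move=> ?; exact: cvg_id.
    apply: withinU_continuous; [exact: cl1 cidR|exact: cl1 cidR| |].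
    * apply: (within_eq (f := fun=> a)); first by move=> t /= ->; rewrite eqxx.
      by apply: continuous_subspaceT; exact: continuous_constant.
    * apply: (within_eq (f := fun=> a')); first by move=> t /= ->; rewrite oner_eq0.
      by apply: continuous_subspaceT; exact: continuous_constant.
  + by rewrite -unit_intervalE.
  + by move=> t /interval_gauge_eq1[->|->]; rewrite ?eqxx ?oner_eq0.
  exists c; split; first by rewrite unit_intervalE.
    by rewrite ce ?eqxx//; apply/interval_gauge_eq1; left.
  by rewrite ce ?oner_eq0//; apply/interval_gauge_eq1; right.
- move=> n x0 b [cb b0]; have G := disk_gauge_cube n.+1.
  have [|||c [cc ce cphi']] := lift _ _ _ G (fun=> x0) b.
  + by apply: continuous_subspaceT; exact: continuous_constant.
  + by rewrite -cubeE.
  + by move=> q q1; rewrite b0// cube_bdryE.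
  exists c; first split.
  + by rewrite cubeE.
  + by move=> y; rewrite cube_bdryE => /ce.
  (* This homotopy starts at [b] after [collar], which is the projection of [c], and ends at [b]; on
     the boundary it is constant since [collar_shrink] fixes the sphere. *)
  exists (fun p => b (collar_shrink (@cube_gauge n.+1) (@cube_scale n.+1) p)); split.
  + apply: within_comp cb; first exact: continuous_collar_shrink G.
    by move=> [t y] [/= t01]; rewrite cubeE => y1; exact: (collar_shrink_disk G).
  + move=> y; rewrite cubeE => y1; split.
      by rewrite collar_shrink0 -cphi'.
    by rewrite (collar_shrink1 G).
  + move=> t y _; rewrite cube_bdryE => y1.
    by rewrite (collar_shrink_sphere G)// b0// cube_bdryE.
- move=> n x0 a a' [ca a0] [ca' a'0] [H [cH H01 Hs]].
  have G := disk_gauge_cylinder n.+1.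
  (* Boundary values on the cylinder: [a] and [a'] on the ends, the base point on the side. They
     agree where these closed pieces meet because [a] and [a'] are [x0] on the boundary of the
     cube. *)
  pose al (q : RR * Rn n.+1) := if q.1 == 0 then a q.2 else if q.1 == 1 then a' q.2 else x0.
  have al0 y : al (0, y) = a y by rewrite /al /= eqxx.
  have al1 y : al (1, y) = a' y by rewrite /al /= oner_eq0 eqxx.
  have als t y : cube_bdry n.+1 y -> al (t, y) = x0.
    by move=> yb; rewrite /al /=; case: ifP => _; [exact: a0|case: ifP => // _; exact: a'0].
  have ccube : closed (cube n.+1) by rewrite cubeE; apply: closed_le_fun;
    [exact: continuous_cube_gauge|exact: continuous_constant].
  have ccubeb : closed (cube_bdry n.+1) by rewrite cube_bdryE; apply: cl1;
    exact: continuous_cube_gauge.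
  have cunit : closed unit_interval by rewrite unit_intervalE; apply: closed_le_fun;
    [exact: continuous_interval_gauge|exact: continuous_constant].
  pose S0 := [set q : RR * Rn n.+1 | q.1 = 0] `&` (snd @^-1` cube n.+1).
  pose S1 := [set q : RR * Rn n.+1 | q.1 = 1] `&` (snd @^-1` cube n.+1).
  pose S2 := (fst @^-1` unit_interval) `&` (snd @^-1` cube_bdry n.+1) : set (RR * Rn n.+1).
  have pre (D : set (Rn n.+1)) : closed D -> closed (snd @^-1` D : set (RR * Rn n.+1)).
    by move=> cD; apply: closed_preimage => //; exact: continuous_snd.
  have cS0 : closed S0 by apply: closedI; [apply: cl1; exact: continuous_fst|exact: pre].
  have cS1 : closed S1 by apply: closedI; [apply: cl1; exact: continuous_fst|exact: pre].
  have cS2 : closed S2.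
    by apply: closedI; [apply: closed_preimage => //; exact: continuous_fst|exact: pre].
  have [|||c [cc ce _]] := lift _ _ _ G al H.
  + have sub : [set q | cylinder_gauge q = 1] `<=` S0 `|` S1 `|` S2.
      by move=> q /cylinder_gauge_eq1[]; [left; left|left; right|right].
    apply: continuous_subspaceW sub _.
    apply: withinU_continuous => //; first exact: closedU.
      apply: withinU_continuous => //.
        apply: (within_eq (f := fun q => a q.2)).
          by move=> [t y] [/= -> _]; rewrite al0.
        by apply: within_comp ca; [exact: continuous_snd|move=> q []].
      apply: (within_eq (f := fun q => a' q.2)).
        by move=> [t y] [/= -> _]; rewrite al1.
      by apply: within_comp ca'; [exact: continuous_snd|move=> q []].
    apply: (within_eq (f := fun=> x0)); first by move=> [t y] [_ /= yb]; rewrite als.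
    by apply: continuous_subspaceT; exact: continuous_constant.
  + by rewrite -cylinderE.
  + move=> [t y] /cylinder_gauge_eq1[[/= -> cy]|[/= -> cy]|[/= ut yb]].
    * by rewrite al0; have [-> _] := H01 _ cy.
    * by rewrite al1; have [_ ->] := H01 _ cy.
    * by rewrite als// Hs.
  exists c; split; first by rewrite cylinderE.
  + move=> y cy; split; rewrite ce ?al0 ?al1//; apply: cylinder_gauge_end => //.
      by left.
    by right.
  + by move=> t y ut yb; rewrite ce ?als//; exact: cylinder_gauge_side.
Qed.

Theorem theorem2p21 :
  forall Y : topologicalType, in_U Y ->
  exists (X : topologicalType) (f : X -> Y) (hf : continuous f),
    [/\ is_KW_complex X, in_U X &
        forall K : topologicalType, compact_hausdorff K ->
          weak_homotopy_equivalence (Map K X) (Map K Y) (@postcomp K X Y f hf)].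
Proof.
move=> Y [_ wY].
(* Indexing by subsets of Y, and not by maps from compact Hausdorff spaces, keeps the index small.
   Nothing is lost: the image of such a map is itself a member, which yields [C_cover]. *)
pose P : choiceType :=
  {A : set Y | `[< closed A /\ compact_hausdorff (set_type A) >]}.
pose C (p : P) : set Y := val p.
have C_closed p : closed (C p) by have /asboolP[] := valP p.
have C_cpt p : compact_hausdorff (set_type (C p)) by have /asboolP[] := valP p.
have C_cover (L : topologicalType) (u : L -> Y) :
    compact_hausdorff L -> continuous u -> exists p, forall l, C p (u l).
  move=> hL cu; have rP : `[< closed (range u) /\ compact_hausdorff (set_type (range u)) >].
    by apply/asboolP; split; [exact: wY|exact: compact_hausdorff_image].
  by exists (exist _ (range u) rP) => l; exists l.
exists (@cech Y P C xpredT), (@cech_proj Y P C xpredT), (@continuous_cech_proj Y P C xpredT).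
split.
- exact: KW_cech.
- by split; [exact: compactly_generated_cech|exact: weak_hausdorff_cech].
move=> K hK; apply: disk_lifting_weak_equivalence.
- exact: continuous_postcomp.
- exact: cech_map_surj.
- exact: cech_map_disk_lifting.
Qed.
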